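(* Let $0>s_1>s_2>\dots$ be the negative roots of $\psi(s)=\psi(1)$. For every fixed integer $N\ge0$, as $n\to\infty$, \[ \mathbb{E}[L_n]=\frac{3}{\pi^2}h_{n-1}^2+\frac{\zeta(3)}{\zeta(2)^2}h_{n-1}+\frac{\zeta(3)^2}{\zeta(2)^3}+\frac1{10}-\frac{3}{\pi^2}\psi'(n)+\sum_{i=1}^N\frac{\Gamma(|s_i|+1)}{(|s_i|+1)\psi'(s_i)}\,\frac{\Gamma(n)}{\Gamma(n+|s_i|+1)}+O\big(n^{-1-|s_{N+1}|}\big). \] In particular, \[ \mathbb{E}[L_n]=\frac{3}{\pi^2}\log^2 n+\Big(\frac{\zeta(3)}{\zeta(2)^2}+\frac{\gamma}{\zeta(2)}\Big)\log n+b_0+O\Big(\frac{\log n}{n}\Big),\quad b_0=\frac{3\gamma^2}{\pi^2}+\frac{\zeta(3)}{\zeta(2)^2}\gamma+\frac{\zeta(3)^2}{\zeta(2)^3}+\frac1{10}. \]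
   Context: For $m\ge2$ let $h_{m-1}=\sum_{i=1}^{m-1}1/i$. The random tree $\mathrm{DTCS}(n)$ is built by recursively splitting the set of $n$ leaves: a block of size $m\ge2$ splits into two blocks of sizes $i$ and $m-i$ with probability $q(m,i)=\frac{m}{2h_{m-1}}\cdot\frac{1}{i(m-i)}$, $1\le i\le m-1$; blocks of size 1 are leaves; each edge has length 1. $L_n$ is the hop-height (number of edges from the root) of a uniformly random leaf of $\mathrm{DTCS}(n)$; equivalently, $L_n$ is the number of steps until absorption at 1 of the discrete-time Markov chain on $\{1,2,\dots\}$ started at $n$ with transition probabilities $\frac{1}{h_{m-1}}\cdot\frac{1}{m-i}$ from $m$ to $i$, $1\le i\le m-1$. $\psi=\Gamma'/\Gamma$ is the digamma function, $\gamma$ Euler's constant, $\zeta$ the Riemann zeta function. All roots of $\psi(s)=\psi(1)$ are real: $s_0=1$ and one root $s_i\in(-i,-(i-1))$ for each $i\ge1$. *)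

(* Defs.v *)
From Stdlib Require Import Reals Factorial.
From Coquelicot Require Import Coquelicot.
Open Scope R_scope.

Fixpoint sum1 (f : nat -> R) (N : nat) : R :=
  match N with
  | O => 0
  | S N' => sum1 f N' + f (S N')
  end.

Definition harm (m : nat) : R := sum1 (fun i => / INR i) m.

(* transition probability of the chain from m to i (1 <= i <= m-1) *)
Definition trans (m i : nat) : R := / harm (m - 1) * / INR (m - i).

(* pL k m = P(L_m = k): law of the absorption time at 1 of the chain
   started at m (first-step / Chapman-Kolmogorov recursion). *)
Fixpoint pL (k m : nat) : R :=
  match k with
  | O => if Nat.eqb m 1 then 1 else 0
  | S k' => if Nat.leb m 1 then 0
            else sum1 (fun i => if Nat.leb m i then 0 else trans m i * pL k' i) (m - 1)
  end.

Definition EL (n : nat) : R := Series (fun k => INR k * pL k n).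

Fixpoint pochn (x : R) (n : nat) : R :=
  match n with
  | O => x
  | S n' => pochn x n' * (x + INR n)
  end.

(* Euler's Gamma function on all of R minus the non-positive integers, via
   Gauss's limit formula Gamma(x) = lim n! n^x / (x(x+1)...(x+n)). *)
Definition Gamma (x : R) : R :=
  real (Lim_seq (fun n => INR (fact n) * Rpower (INR n) x / pochn x n)).

Definition psi (x : R) : R := Derive Gamma x / Gamma x.
Definition psi1 (x : R) : R := Derive psi x.

Definition zeta (k : nat) : R := Series (fun j => / (INR j + 1) ^ k).

Definition euler_gamma : R := real (Lim_seq (fun n => harm n - ln (INR n))).

Definition main_term (s : nat -> R) (N n : nat) : R :=
  3 / PI ^ 2 * harm (n - 1) ^ 2 + zeta 3 / zeta 2 ^ 2 * harm (n - 1)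
  + zeta 3 ^ 2 / zeta 2 ^ 3 + 1 / 10 - 3 / PI ^ 2 * psi1 (INR n)
  + sum1 (fun i => Gamma (Rabs (s i) + 1) / ((Rabs (s i) + 1) * psi1 (s i))
                   * (Gamma (INR n) / Gamma (INR n + Rabs (s i) + 1))) N.

Definition b0 : R :=
  3 * euler_gamma ^ 2 / PI ^ 2 + zeta 3 / zeta 2 ^ 2 * euler_gamma
  + zeta 3 ^ 2 / zeta 2 ^ 3 + 1 / 10.

(* Main.v *)
(** The binomials [C(n - 1, j)] are eigenfunctions of the generator of the
    continuous-time chain with rates [1/(m - i)], with eigenvalues [h_j]; hence
    [E L_n = sum_{1<=j<n} (-1)^(j+1) C(n - 1, j) / (j h_j)].
    Here [h_j = g(j)] with [g(x) = psi(1 + x) - psi(1) = lim g_K(x)],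
    [g_K(x) = sum_{k<=K} (1/k - 1/(k + x))], and the expansion comes from the partial fractions of
    [1/(x g(x))]: the double pole at 0 gives the [h^2], [h] and [psi'] terms, and a pole
    [-a = s_i - 1] gives the Beta integral [Gamma(n) Gamma(a) / Gamma(n + a)].
    The partial fractions are obtained without complex analysis. The rational function [g_K] has [K]
    real zeros [z] (0, and one in each gap between consecutive poles), and the [K] vectors
    [(1/(k + z))_{k<=K}] form an orthogonal basis of R^K with squared norms [g_K'(z)].
    Parseval's identity in this basis, applied to [(1/k^2)] and [(1/(k + x))], yields the partial
    fraction expansion of [1/(x g_K(x))], and applied to [(1/k^2)] twice it evaluates the sum of the
    constants as [zeta(4)/zeta(2)^2 - zeta(3)^2/zeta(2)^3]. One then lets [K] tend to infinity, the
    Beta integrals with [a >= a_{N+1}] being dominated by the first of them. *)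

Require Import Defs.
From Stdlib Require Import Reals Ranalysis5 Arith Lra Lia Psatz Factorial.
From Coquelicot Require Import Coquelicot.
Open Scope R_scope.

(** * The closed form of the expectation *)

(** Evaluating the alternating sum by residues would need growth estimates for [1/g] on large
    contours. Cutting [g] down to [K] poles replaces them by linear algebra in finite dimension; the
    price is that every estimate must be uniform in [K]. One fact provides this: in the gap
    [(-i-1, -i)] the pole [-i] alone contributes at least 1 to [g_K']. Hence zeros of [g_K] move by
    at most the value of [g_K] at the limiting root, and each coefficient [1/(g_K'(z) a)], with
    [a = -z], is at most [1/a]. Only finitely many residues are kept explicitly, the others being
    bounded before the limit is taken, so no limit is exchanged with an infinite sum. The other
    burden is [Gamma], a pointwise limit on the whole line: [psi] and [psi1] at the negative roots
    have to be identified with limits of finite sums, first on the positive axis and then gap by gap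
    through the functional equation. *)

Lemma sum1_S (f : nat -> R) (n : nat) : sum1 f (S n) = sum1 f n + f (S n).
Proof. reflexivity. Qed.

Lemma sum1_ext (f g : nat -> R) (n : nat) :
  (forall k, (1 <= k <= n)%nat -> f k = g k) -> sum1 f n = sum1 g n.
Proof.
  induction n as [|n IH]; intros H; simpl; [reflexivity|].
  rewrite IH by (intros; apply H; lia). rewrite H by lia. reflexivity.
Qed.

Lemma sum1_plus (f g : nat -> R) (n : nat) :
  sum1 (fun k => f k + g k) n = sum1 f n + sum1 g n.
Proof. induction n; simpl; lra. Qed.

Lemma sum1_minus (f g : nat -> R) (n : nat) :
  sum1 (fun k => f k - g k) n = sum1 f n - sum1 g n.
Proof. induction n; simpl; lra. Qed.

Lemma sum1_scal (c : R) (f : nat -> R) (n : nat) :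
  sum1 (fun k => c * f k) n = c * sum1 f n.
Proof. induction n as [|n IH]; simpl; [|rewrite IH]; lra. Qed.

Lemma sum1_le (f g : nat -> R) (n : nat) :
  (forall k, (1 <= k <= n)%nat -> f k <= g k) -> sum1 f n <= sum1 g n.
Proof.
  induction n as [|n IH]; intros H; simpl; [lra|].
  apply Rplus_le_compat; [apply IH; intros|]; apply H; lia.
Qed.

Lemma sum1_const (c : R) (n : nat) : sum1 (fun _ => c) n = INR n * c.
Proof. induction n as [|n IH]; [simpl; lra|]. rewrite S_INR. simpl sum1. rewrite IH. lra. Qed.

Lemma sum1_0 (f : nat -> R) (n : nat) :
  (forall k, (1 <= k <= n)%nat -> f k = 0) -> sum1 f n = 0.
Proof. intros H. rewrite (sum1_ext _ (fun _ => 0)) by exact H. rewrite sum1_const. lra. Qed.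

Lemma sum1_ge0 (f : nat -> R) (n : nat) :
  (forall k, (1 <= k <= n)%nat -> 0 <= f k) -> 0 <= sum1 f n.
Proof.
  intros H. rewrite <- (sum1_0 (fun _ => 0) n) by reflexivity. apply sum1_le, H.
Qed.

Lemma sum1_ge_term (f : nat -> R) (n i : nat) :
  (forall k, (1 <= k <= n)%nat -> 0 <= f k) -> (1 <= i <= n)%nat -> f i <= sum1 f n.
Proof.
  induction n as [|n IH]; intros H Hi; [lia|]. simpl.
  assert (0 <= f (S n)) by (apply H; lia).
  destruct (Nat.eq_dec i (S n)) as [->|Hne].
  - assert (0 <= sum1 f n) by (apply sum1_ge0; intros; apply H; lia). lra.
  - assert (f i <= sum1 f n) by (apply IH; [intros; apply H|]; lia). lra.
Qed.

Lemma sum1_exchange (f : nat -> nat -> R) (m n : nat) :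
  sum1 (fun i => sum1 (fun j => f i j) n) m = sum1 (fun j => sum1 (fun i => f i j) m) n.
Proof.
  induction m as [|m IH]; simpl.
  - symmetry. apply sum1_0. reflexivity.
  - rewrite IH, <- sum1_plus. reflexivity.
Qed.

Lemma sum1_pick (f : nat -> R) (n i : nat) : (1 <= i <= n)%nat ->
  sum1 (fun k => if Nat.eqb i k then f k else 0) n = f i.
Proof.
  induction n as [|n IH]; intros Hi; [lia|]. simpl.
  destruct (Nat.eqb_spec i (S n)) as [->|Hne].
  - rewrite sum1_0; [lra|]. intros k Hk.
    destruct (Nat.eqb_spec (S n) k); [lia|reflexivity].
  - rewrite IH by lia. lra.
Qed.

Lemma sum1_first (f : nat -> R) (n : nat) :
  sum1 f (S n) = f 1%nat + sum1 (fun k => f (S k)) n.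
Proof. induction n as [|n IH]; [simpl; lra|]. change (sum1 f (S (S n))) with (sum1 f (S n) + f (S (S n))). rewrite IH. simpl. lra. Qed.

Lemma sum1_app (f : nat -> R) (m n : nat) :
  sum1 f (m + n) = sum1 f m + sum1 (fun k => f (m + k)%nat) n.
Proof.
  induction n as [|n IH]; [rewrite Nat.add_0_r; simpl; lra|].
  rewrite Nat.add_succ_r. simpl. rewrite IH, Nat.add_succ_r. lra.
Qed.

Lemma sum1_rev (f : nat -> R) (n : nat) : sum1 f n = sum1 (fun k => f (S n - k)%nat) n.
Proof.
  induction n as [|n IH]; [reflexivity|].
  rewrite (sum1_first (fun k => f (S (S n) - k)%nat)).
  replace (S (S n) - 1)%nat with (S n) by lia. simpl sum1 at 1. rewrite IH.
  rewrite Rplus_comm. reflexivity.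
Qed.

Lemma sum1_mult (f g : nat -> R) (m n : nat) :
  sum1 f m * sum1 g n = sum1 (fun i => sum1 (fun j => f i * g j) n) m.
Proof.
  rewrite Rmult_comm, <- sum1_scal. apply sum1_ext. intros i _.
  rewrite sum1_scal. ring.
Qed.

Lemma INR_gt0 (k : nat) : (1 <= k)%nat -> 0 < INR k.
Proof. intros H. apply lt_0_INR. lia. Qed.

Lemma harm_gt0 (n : nat) : (1 <= n)%nat -> 0 < harm n.
Proof.
  intros H. apply Rlt_le_trans with (/ INR 1); [simpl; lra|].
  apply (sum1_ge_term (fun i => / INR i)); [|lia].
  intros k Hk. apply Rlt_le, Rinv_0_lt_compat, INR_gt0. lia.
Qed.

(** Pascal's recursion makes the value 0 for [j > n], so alternating sums with different upper
    indices can be written over a common range. *)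
Fixpoint binom (n j : nat) : R :=
  match n, j with
  | _, O => 1
  | O, S _ => 0
  | S n', S j' => binom n' j' + binom n' (S j')
  end.

Lemma binom_0 (n : nat) : binom n 0 = 1.
Proof. destruct n; reflexivity. Qed.

Lemma binom_gt (n j : nat) : (n < j)%nat -> binom n j = 0.
Proof.
  revert j; induction n as [|n IH]; intros [|j] H; try lia; [reflexivity|].
  simpl. rewrite !IH by lia. lra.
Qed.

Lemma binom_absorb (n j : nat) : INR (S j) * binom (S n) (S j) = INR (S n) * binom n j.
Proof.
  revert j; induction n as [|n IH]; intros [|j].
  - simpl; lra.
  - simpl; lra.
  - change (binom (S (S n)) 1) with (binom (S n) 0 + binom (S n) 1).
    specialize (IH O). rewrite binom_0 in IH |- *. rewrite (S_INR (S n)). simpl (INR 1) in *. lra.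
  - change (binom (S (S n)) (S (S j))) with (binom (S n) (S j) + binom (S n) (S (S j))).
    rewrite Rmult_plus_distr_l, IH. rewrite (S_INR (S j)).
    rewrite Rmult_plus_distr_r, IH. rewrite (S_INR (S n)).
    change (binom (S n) (S j)) with (binom n j + binom n (S j)). lra.
Qed.

(* The binomial basis diagonalises the generator of the continuous-time chain with rates 1/(m-i). *)
Lemma binom_generator (N j : nat) :
  sum1 (fun d => (binom N j - binom (N - d) j) / INR d) N = harm j * binom N j.
Proof.
  revert j; induction N as [|N IH]; intros j.
  - destruct j; simpl; [|]; unfold harm; simpl; lra.
  - destruct j as [|j].
    + rewrite sum1_0; [unfold harm; simpl; lra|].
      intros k Hk. rewrite !binom_0. unfold Rdiv. lra.
    + pose proof (IH j) as H1. pose proof (IH (S j)) as H2.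
      rewrite sum1_S, Nat.sub_diag. change (binom 0 (S j)) with 0.
      rewrite (sum1_ext _ (fun d => (binom N j - binom (N - d) j) / INR d
        + (binom N (S j) - binom (N - d) (S j)) / INR d)).
      2:{ intros d Hd. replace (S N - d)%nat with (S (N - d)) by lia.
          change (binom (S N) (S j)) with (binom N j + binom N (S j)).
          change (binom (S (N - d)) (S j)) with (binom (N - d) j + binom (N - d) (S j)).
          unfold Rdiv. ring. }
      rewrite sum1_plus, H1, H2.
      pose proof (binom_absorb N j) as Ha.
      change (harm (S j)) with (harm j + / INR (S j)).
      assert (HN : 0 < INR (S N)) by (apply INR_gt0; lia).
      assert (Hj : 0 < INR (S j)) by (apply INR_gt0; lia).
      (* Pascal's rule and the two induction hypotheses give [h_j C(N,j) + h_(j+1) C(N,j+1)] from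
         the jumps [d <= N]. The remaining jump [d = N+1] adds [C(N,j)/(j+1)], which raises the
         first [h_j] to [h_(j+1)]. *)
      assert (E : (binom (S N) (S j) - 0) / INR (S N) = binom N j / INR (S j)).
      { rewrite Rminus_0_r. apply Rmult_eq_reg_r with (INR (S N) * INR (S j)); [|nra].
        transitivity (INR (S j) * binom (S N) (S j)); [field; lra|]. rewrite Ha. field. lra. }
      rewrite E. change (binom (S N) (S j)) with (binom N j + binom N (S j)).
      unfold Rdiv. ring.
Qed.

(** A Noerlund-Rice sum without its term [j = 0]. Being linear in the weight, it can be evaluated on
    each partial fraction separately. *)
Definition altsum (N : nat) (w : nat -> R) : R :=
  sum1 (fun j => (-1) ^ (S j) * binom N j * w j) N.

Lemma altsum_ge (N M : nat) (w : nat -> R) : (N <= M)%nat ->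
  sum1 (fun j => (-1) ^ (S j) * binom N j * w j) M = altsum N w.
Proof.
  intros H. replace M with (N + (M - N))%nat by lia. rewrite sum1_app.
  rewrite (sum1_0 (fun k => (-1) ^ S (N + k) * binom N (N + k) * w (N + k)%nat)).
  - apply Rplus_0_r.
  - intros k Hk. rewrite binom_gt by lia. ring.
Qed.

Lemma altsum_ext (N : nat) (w w' : nat -> R) :
  (forall j, (1 <= j)%nat -> w j = w' j) -> altsum N w = altsum N w'.
Proof. intros H. apply sum1_ext. intros k Hk. rewrite H by lia. reflexivity. Qed.

Lemma altsum_plus (N : nat) (w w' : nat -> R) :
  altsum N (fun j => w j + w' j) = altsum N w + altsum N w'.
Proof.
  unfold altsum. rewrite <- sum1_plus. apply sum1_ext. intros. ring.
Qed.

Lemma altsum_scal (N : nat) (c : R) (w : nat -> R) :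
  altsum N (fun j => c * w j) = c * altsum N w.
Proof.
  unfold altsum. rewrite <- sum1_scal. apply sum1_ext. intros. ring.
Qed.

Lemma altsum_sum1 (N m : nat) (w : nat -> nat -> R) :
  altsum N (fun j => sum1 (fun i => w i j) m) = sum1 (fun i => altsum N (w i)) m.
Proof.
  unfold altsum. rewrite <- sum1_exchange. apply sum1_ext. intros j _.
  rewrite <- sum1_scal. reflexivity.
Qed.

Lemma altsum_succ (N : nat) (w : nat -> R) :
  altsum (S N) w = altsum N w
    + sum1 (fun j => (-1) ^ (S j) * binom N (j - 1) * w j) (S N).
Proof.
  rewrite <- (altsum_ge N (S N)) by lia. unfold altsum. rewrite <- sum1_plus.
  apply sum1_ext. intros [|j] Hj; [lia|].
  change (binom (S N) (S j)) with (binom N j + binom N (S j)).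
  replace (S j - 1)%nat with j by lia. ring.
Qed.

(** Absorption turns the Pascal increment [C(N,j-1)/j] into [C(N+1,j)/(N+1)]. Dividing the weight by
    [j] therefore amounts to summing [altsum M w / M] over [M <= N]; from the weight 1 this produces
    [h_N], then the sum of [h_M/M]. *)
Lemma altsum_div (N : nat) (w : nat -> R) :
  altsum (S N) (fun j => w j / INR j)
  = altsum N (fun j => w j / INR j) + altsum (S N) w / INR (S N).
Proof.
  rewrite altsum_succ. f_equal. unfold altsum, Rdiv.
  rewrite (Rmult_comm (sum1 _ _)), <- sum1_scal. apply sum1_ext. intros [|j] Hj; [lia|].
  replace (S j - 1)%nat with j by lia. pose proof (binom_absorb N j) as Ha.
  assert (HN : 0 < INR (S N)) by (apply INR_gt0; lia).
  assert (Hj' : 0 < INR (S j)) by (apply INR_gt0; lia).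
  apply Rmult_eq_reg_r with (INR (S N) * INR (S j)); [|nra].
  transitivity ((-1) ^ S (S j) * (INR (S N) * binom N j) * w (S j)); [field; lra|].
  rewrite <- Ha. field; lra.
Qed.

Lemma altsum_one (N : nat) : (1 <= N)%nat -> altsum N (fun _ => 1) = 1.
Proof.
  intros H. induction N as [|N IH]; [lia|].
  destruct N as [|N].
  - unfold altsum. simpl. lra.
  - rewrite altsum_succ, IH by lia.
    rewrite sum1_first.
    rewrite (sum1_ext _ (fun j => -1 * ((-1) ^ S j * binom (S N) j * 1))).
    2:{ intros j Hj. replace (S j - 1)%nat with j by lia. simpl. ring. }
    rewrite sum1_scal. fold (altsum (S N) (fun _ => 1)). rewrite IH by lia.
    replace (1 - 1)%nat with 0%nat by lia. rewrite binom_0. simpl. lra.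
Qed.

Lemma altsum_inv (N : nat) : altsum N (fun j => / INR j) = harm N.
Proof.
  induction N as [|N IH]; [reflexivity|].
  rewrite (altsum_ext _ _ (fun j => 1 / INR j)) by (intros; unfold Rdiv; ring).
  rewrite altsum_div, altsum_one by lia.
  rewrite (altsum_ext _ (fun j => 1 / INR j) (fun j => / INR j)) by (intros; unfold Rdiv; ring).
  rewrite IH. unfold harm. rewrite sum1_S. unfold Rdiv. ring.
Qed.

(** The value is the sum of [h_M/M] over [M <= N], the complete symmetric function of degree 2 in
    [1, 1/2, ..., 1/N]. It is the contribution of the double pole at 0. *)
Lemma altsum_inv2 (N : nat) :
  altsum N (fun j => / INR j ^ 2) = (harm N ^ 2 + sum1 (fun i => / INR i ^ 2) N) / 2.
Proof.
  assert (E : forall M, altsum M (fun j => / INR j ^ 2) = altsum M (fun j => / INR j / INR j)).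
  { intros M. apply altsum_ext. intros j Hj. pose proof (INR_gt0 j Hj). field. lra. }
  induction N as [|N IH]; [unfold altsum, harm; simpl; lra|].
  rewrite E, altsum_div, altsum_inv, <- E, IH.
  change (harm (S N)) with (harm N + / INR (S N)).
  change (sum1 (fun i => / INR i ^ 2) (S N))
    with (sum1 (fun i => / INR i ^ 2) N + / INR (S N) ^ 2).
  assert (HN : 0 < INR (S N)) by (apply INR_gt0; lia). field. lra.
Qed.

(* [beta_int N a] is the Beta integral [B(N + 1, a)]. *)
Definition beta_int (N : nat) (a : R) : R := INR (fact N) / pochn a N.

Lemma pochn_gt0 (a : R) (N : nat) : 0 < a -> 0 < pochn a N.
Proof.
  intros Ha. induction N as [|N IH]; [exact Ha|]. change (0 < pochn a N * (a + INR (S N))).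
  pose proof (pos_INR (S N)). apply Rmult_lt_0_compat; lra.
Qed.

Lemma pochn_shift (x : R) (n : nat) : x * pochn (x + 1) n = pochn x n * (x + INR n + 1).
Proof.
  induction n as [|n IH]; [simpl; ring|].
  change (x * (pochn (x + 1) n * (x + 1 + INR (S n))) = pochn x n * (x + INR (S n)) * (x + INR (S n) + 1)).
  rewrite <- Rmult_assoc, IH, S_INR. ring.
Qed.

(** Both sides are the integral of [t^(a-1) (1 - (1-t)^N)] over [[0,1]]; [1/a] is the omitted term
    [j = 0]. Pascal's rule becomes [B(N+2,a) = B(N+1,a) - B(N+1,a+1)], so the induction runs over
    all [a] at once. *)
Lemma altsum_shifted (N : nat) (a : R) : 0 < a ->
  altsum N (fun j => / (INR j + a)) = / a - beta_int N a.
Proof.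
  revert a; induction N as [|N IH]; intros a Ha.
  - unfold altsum, beta_int. simpl. field. lra.
  - rewrite altsum_succ, IH by lra. rewrite sum1_first.
    rewrite (sum1_ext _ (fun j => -1 * ((-1) ^ S j * binom N j * / (INR j + (a + 1))))).
    2:{ intros j Hj. replace (S j - 1)%nat with j by lia. rewrite S_INR.
        replace (INR j + 1 + a) with (INR j + (a + 1)) by ring. simpl. ring. }
    rewrite sum1_scal. fold (altsum N (fun j => / (INR j + (a + 1)))). rewrite IH by lra.
    replace (1 - 1)%nat with 0%nat by lia. rewrite binom_0. unfold beta_int.
    pose proof (pochn_shift a N) as Hs.
    pose proof (pochn_gt0 a N Ha). pose proof (pos_INR N).
    assert (Hp : pochn (a + 1) N = pochn a N * (a + INR N + 1) / a).
    { rewrite <- Hs. field. lra. }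
    rewrite Hp. change (pochn a (S N)) with (pochn a N * (a + INR (S N))).
    change (fact (S N)) with ((S N) * fact N)%nat. rewrite mult_INR, S_INR.
    rewrite !S_INR. change (INR 0) with 0. simpl ((-1) ^ 2). field. lra.
Qed.

(* The solution of the first-step equation in the eigenbasis of [binom_generator]. *)
Definition EL_closed (n : nat) : R := altsum (n - 1) (fun j => / (INR j * harm j)).

Lemma EL_closed_rec (n : nat) : (2 <= n)%nat ->
  EL_closed n = sum1 (fun i => trans n i * (EL_closed i + 1)) (n - 1).
Proof.
  intros Hn. set (N := (n - 1)%nat).
  assert (Hh : 0 < harm N) by (apply harm_gt0; unfold N; lia).
  set (w := fun j : nat => / (INR j * harm j)).
  (* From here on the sum is indexed by the jump size [d = n - i], whose rate is [1/d]. *)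
  rewrite sum1_rev.
  rewrite (sum1_ext _ (fun d => / harm N * (/ INR d * (altsum N w + 1)
      - sum1 (fun j => (-1) ^ S j * w j * ((binom N j - binom (N - d) j) / INR d)) N))).
  2:{ intros d Hd. unfold trans, EL_closed. fold N. fold w.
      replace (n - (S N - d))%nat with d by (unfold N; lia).
      replace (S N - d - 1)%nat with (N - d)%nat by lia.
      rewrite <- (altsum_ge (N - d) N) by lia.
      assert (E : sum1 (fun j => (-1) ^ S j * w j * ((binom N j - binom (N - d) j) / INR d)) N
        = / INR d * (altsum N w - sum1 (fun j => (-1) ^ S j * binom (N - d) j * w j) N)).
      { unfold altsum. rewrite <- sum1_minus, <- sum1_scal. apply sum1_ext. intros. unfold Rdiv; ring. }
      rewrite E. ring. }
  rewrite sum1_scal, sum1_minus.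
  rewrite (sum1_ext (fun k => / INR k * (altsum N w + 1)) (fun k => (altsum N w + 1) * / INR k))
    by (intros; ring).
  rewrite sum1_scal. fold (harm N). rewrite sum1_exchange.
  (* The eigenvalue [h_j] cancels the [h_j] in the weight. What is left is the alternating sum of
     [1/j], that is [h_N], the total jump rate: it pays exactly for the added 1 of the first-step
     equation. *)
  rewrite (sum1_ext _ (fun j => (-1) ^ S j * binom N j * / INR j)).
  2:{ intros j Hj. rewrite sum1_scal, binom_generator. unfold w.
      assert (0 < harm j) by (apply harm_gt0; lia). assert (0 < INR j) by (apply INR_gt0; lia).
      field. lra. }
  fold (altsum N (fun j => / INR j)). rewrite altsum_inv.
  unfold EL_closed. fold N. fold w. field. lra.
Qed.

(** * The law of the absorption time *)

Lemma trans_sum (n : nat) : (2 <= n)%nat -> sum1 (trans n) (n - 1) = 1.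
Proof.
  intros Hn. unfold trans. rewrite sum1_scal, sum1_rev.
  rewrite (sum1_ext _ (fun i => / INR i)).
  2:{ intros k Hk. do 2 f_equal. lia. }
  fold (harm (n - 1)). apply Rinv_l. apply Rgt_not_eq, harm_gt0. lia.
Qed.

Lemma pL_succ (k n : nat) : (2 <= n)%nat ->
  pL (S k) n = sum1 (fun i => trans n i * pL k i) (n - 1).
Proof.
  intros Hn. simpl. destruct (Nat.leb_spec n 1); [lia|].
  apply sum1_ext. intros i Hi. destruct (Nat.leb_spec n i); [lia|reflexivity].
Qed.

(** The chain strictly decreases, so absorption takes at most [n - 1] steps and the partial sums are
    already exact. Mass and mean are proved together because the mean after one step involves the
    mass; [pL 0 n] stands apart because [sum1] starts at index 1. *)
Lemma pL_partial_sums (n K : nat) : (1 <= n)%nat -> (n - 1 <= K)%nat ->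
  pL 0 n + sum1 (fun k => pL k n) K = 1
  /\ sum1 (fun k => INR k * pL k n) K = EL_closed n.
Proof.
  revert K. induction n as [n IH] using (well_founded_induction Nat.lt_wf_0). intros K Hn HK.
  destruct (Nat.eq_dec n 1) as [->|Hn1].
  - assert (Z : forall k, (1 <= k <= K)%nat -> pL k 1 = 0) by (intros [|k] Hk; [lia|reflexivity]).
    split.
    + rewrite sum1_0 by exact Z. simpl. lra.
    + rewrite sum1_0; [reflexivity|]. intros k Hk. rewrite Z by exact Hk. ring.
  - destruct K as [|K]; [lia|].
    assert (H0 : pL 0 n = 0) by (simpl; destruct (Nat.eqb_spec n 1); [lia|reflexivity]).
    assert (IH0 : forall i, (1 <= i <= n - 1)%nat -> pL 0 i + sum1 (fun k => pL k i) K = 1)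
      by (intros i Hi; apply IH; lia).
    assert (IH1 : forall i, (1 <= i <= n - 1)%nat ->
      sum1 (fun k => INR k * pL k i) K = EL_closed i) by (intros i Hi; apply IH; lia).
    rewrite H0, !sum1_first. rewrite !pL_succ by lia. split.
    + rewrite (sum1_ext (fun k => pL (S k) n) (fun k => sum1 (fun i => trans n i * pL k i) (n - 1)))
        by (intros; apply pL_succ; lia).
      rewrite sum1_exchange, <- sum1_plus.
      rewrite (sum1_ext _ (trans n)); [rewrite trans_sum by lia; lra|].
      intros i Hi. rewrite sum1_scal, <- Rmult_plus_distr_l, IH0 by lia. ring.
    + rewrite (sum1_ext (fun k => INR (S k) * pL (S k) n)
        (fun k => sum1 (fun i => trans n i * (INR k * pL k i + pL k i)) (n - 1))).
      2:{ intros k Hk. rewrite pL_succ, S_INR, <- sum1_scal by lia. apply sum1_ext. intros; ring. }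
      rewrite sum1_exchange. simpl (INR 1). rewrite Rmult_1_l, <- sum1_plus.
      rewrite EL_closed_rec by lia. apply sum1_ext. intros i Hi.
      rewrite sum1_scal, sum1_plus, IH1 by lia. rewrite <- (IH0 i Hi). ring.
Qed.

Lemma sum_n_sum1 (f : nat -> R) (n : nat) : sum_n f n = f O + sum1 f n.
Proof.
  induction n as [|n IH]; [rewrite sum_O; simpl; lra|].
  rewrite sum_Sn, IH. unfold plus; simpl. lra.
Qed.

Lemma EL_eq (n : nat) : (1 <= n)%nat -> EL n = EL_closed n.
Proof.
  intros Hn. unfold EL. apply is_series_unique.
  change (is_lim_seq (sum_n (fun k => INR k * pL k n)) (EL_closed n)).
  apply (is_lim_seq_ext_loc (fun _ => EL_closed n)); [|apply is_lim_seq_const].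
  exists n. intros K HK. rewrite sum_n_sum1. simpl (INR 0).
  destruct (pL_partial_sums n K Hn ltac:(lia)) as [_ ->]. ring.
Qed.

(** * Finite partial fractions *)

Lemma sum1_ge0_eq0 (f : nat -> R) (n i : nat) :
  (forall k, (1 <= k <= n)%nat -> 0 <= f k) -> sum1 f n = 0 -> (1 <= i <= n)%nat -> f i = 0.
Proof.
  intros Hf H0 Hi. pose proof (sum1_ge_term f n i Hf Hi). pose proof (Hf i Hi). lra.
Qed.

(* [K] orthogonal vectors of R^K are complete: if [P] is the orthogonal projection on their span
   then the squared Frobenius norm of [I - P] is [K - 2 tr P + tr P = 0]. *)
Lemma orthogonal_projection_id (K : nat) (v : nat -> nat -> R) (d : nat -> R) :
  (forall i, (1 <= i <= K)%nat -> d i <> 0) ->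
  (forall i j, (1 <= i <= K)%nat -> (1 <= j <= K)%nat ->
     sum1 (fun k => v i k * v j k) K = if Nat.eqb i j then d i else 0) ->
  forall k l, (1 <= k <= K)%nat -> (1 <= l <= K)%nat ->
    sum1 (fun i => v i k * v i l / d i) K = if Nat.eqb k l then 1 else 0.
Proof.
  intros Hd Ho.
  set (P := fun k l => sum1 (fun i => v i k * v i l / d i) K).
  assert (Hidem : forall k m, sum1 (fun l => P k l * P m l) K = P k m).
  { intros k m.
    rewrite (sum1_ext _ (fun l => sum1 (fun i => sum1 (fun j =>
       v i k / d i * (v j m / d j) * (v i l * v j l)) K) K)).
    2:{ intros l _. unfold P. rewrite sum1_mult. apply sum1_ext; intros i _.
        apply sum1_ext; intros j _. unfold Rdiv. ring. }
    rewrite sum1_exchange. unfold P. apply sum1_ext. intros i Hi.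
    rewrite sum1_exchange.
    rewrite (sum1_ext _ (fun j => if Nat.eqb i j then v i k * v j m / d j else 0)).
    - apply sum1_pick. exact Hi.
    - intros j Hj. rewrite sum1_scal, Ho by assumption. pose proof (Hd j Hj).
      destruct (Nat.eqb_spec i j) as [->|_]; [field; assumption|ring]. }
  assert (Htr : sum1 (fun k => P k k) K = INR K).
  { unfold P. rewrite sum1_exchange. rewrite (sum1_ext _ (fun _ => 1)).
    - rewrite sum1_const. ring.
    - intros i Hi. rewrite (sum1_ext _ (fun k => / d i * (v i k * v i k))) by (intros; unfold Rdiv; ring).
      rewrite sum1_scal, Ho, Nat.eqb_refl by assumption. apply Rinv_l, Hd, Hi. }
  assert (Hnorm : sum1 (fun k => sum1 (fun l => ((if Nat.eqb k l then 1 else 0) - P k l) ^ 2) K) K = 0).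
  { rewrite (sum1_ext _ (fun k => 1 - P k k)).
    - rewrite sum1_minus, Htr, sum1_const. ring.
    - intros k Hk.
      rewrite (sum1_ext _ (fun l => (if Nat.eqb k l then 1 - 2 * P k l else 0) + P k l * P k l)).
      + rewrite sum1_plus, Hidem. rewrite (sum1_pick (fun l => 1 - 2 * P k l)) by exact Hk. ring.
      + intros l _. destruct (Nat.eqb k l); ring. }
  intros k l Hk Hl. change (P k l = if Nat.eqb k l then 1 else 0).
  assert (H1 : sum1 (fun l => ((if Nat.eqb k l then 1 else 0) - P k l) ^ 2) K = 0).
  { apply (sum1_ge0_eq0 (fun k => sum1 (fun l => ((if Nat.eqb k l then 1 else 0) - P k l) ^ 2) K) K k);
      [|exact Hnorm|exact Hk].
    intros; apply sum1_ge0; intros; apply pow2_ge_0. }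
  assert (H2 := sum1_ge0_eq0 _ K l (fun _ _ => pow2_ge_0 _) H1 Hl). simpl in H2.
  nra.
Qed.

Lemma parseval (K : nat) (v : nat -> nat -> R) (d : nat -> R) :
  (forall i, (1 <= i <= K)%nat -> d i <> 0) ->
  (forall i j, (1 <= i <= K)%nat -> (1 <= j <= K)%nat ->
     sum1 (fun k => v i k * v j k) K = if Nat.eqb i j then d i else 0) ->
  forall p q : nat -> R,
    sum1 (fun k => p k * q k) K
    = sum1 (fun i => sum1 (fun k => p k * v i k) K * sum1 (fun k => q k * v i k) K / d i) K.
Proof.
  intros Hd Ho p q.
  pose proof (orthogonal_projection_id K v d Hd Ho) as HP.
  rewrite (sum1_ext _ (fun k => sum1 (fun l => sum1 (fun i => p k * v i k * (q l * v i l) / d i) K) K)).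
  2:{ intros k Hk. rewrite (sum1_ext _ (fun l => if Nat.eqb k l then p k * q l else 0)).
      - symmetry. apply (sum1_pick (fun l => p k * q l)). exact Hk.
      - intros l Hl.
        rewrite (sum1_ext _ (fun i => p k * q l * (v i k * v i l / d i))) by (intros; unfold Rdiv; ring).
        rewrite sum1_scal, HP by assumption. destruct (Nat.eqb k l); ring. }
  rewrite (sum1_ext _ (fun k => sum1 (fun i => sum1 (fun l => p k * v i k * (q l * v i l) / d i) K) K))
    by (intros; apply sum1_exchange).
  rewrite sum1_exchange. apply sum1_ext. intros i Hi.
  rewrite sum1_mult. unfold Rdiv. rewrite Rmult_comm, <- sum1_scal.
  apply sum1_ext. intros k Hk. rewrite <- sum1_scal. apply sum1_ext. intros. ring.
Qed.

(* [gK K x] tends to [psi (1 + x) - psi 1] as [K] tends to infinity, and [dgK K] is its derivative. *)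
Definition gK (K : nat) (x : R) : R := sum1 (fun k => / INR k - / (INR k + x)) K.

Definition dgK (K : nat) (x : R) : R := sum1 (fun k => / (INR k + x) ^ 2) K.

Definition zetaK (p K : nat) : R := sum1 (fun k => / INR k ^ p) K.

(** The gap between the consecutive poles [-(i+1)] and [-i] of [gK]. It contains [s_i - 1], since
    [psi(s) = psi(1)] reads [g(s-1) = 0]. *)
Definition in_gap (i : nat) (x : R) : Prop := - INR i - 1 < x < - INR i.

Lemma in_gap_neq0 (i k : nat) (x : R) : in_gap i x -> INR k + x <> 0.
Proof.
  intros [H1 H2] H. destruct (le_lt_dec k i) as [Hk|Hk].
  - apply le_INR in Hk. lra.
  - apply (le_INR (S i)) in Hk. rewrite S_INR in Hk. lra.
Qed.

Lemma in_gap_same_sign (i k : nat) (x y : R) :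
  in_gap i x -> in_gap i y -> 0 < (INR k + x) * (INR k + y).
Proof.
  intros [H1 H2] [H3 H4]. destruct (le_lt_dec k i) as [Hk|Hk].
  - apply le_INR in Hk. nra.
  - apply (le_INR (S i)) in Hk. rewrite S_INR in Hk. apply Rmult_lt_0_compat; lra.
Qed.

(** This divided difference serves twice: between two zeros it gives orthogonality, and within one
    gap, where all its terms are positive, it gives monotonicity with slope at least 1. *)
Lemma gK_diff (K : nat) (x y : R) :
  (forall k, (1 <= k <= K)%nat -> INR k + x <> 0) ->
  (forall k, (1 <= k <= K)%nat -> INR k + y <> 0) ->
  gK K x - gK K y = (x - y) * sum1 (fun k => / (INR k + x) * / (INR k + y)) K.
Proof.
  intros Hx Hy. unfold gK. rewrite <- sum1_minus, <- sum1_scal. apply sum1_ext.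
  intros k Hk. pose proof (INR_gt0 k ltac:(lia)). field. split; [|split]; [apply Hy, Hk|apply Hx, Hk|lra].
Qed.

Lemma gK_0 (K : nat) : gK K 0 = 0.
Proof. apply sum1_0. intros k Hk. rewrite Rplus_0_r. ring. Qed.

(** Termwise, [1/(k^2 (k+x)) = 1/(k^2 x) - (1/k - 1/(k+x))/x^2]. At a nonzero zero of [gK] the
    second part drops out, so the coordinate of [(1/k^2)] is explicit. *)
Lemma zetaK_moment (K : nat) (x : R) : x <> 0 ->
  (forall k, (1 <= k <= K)%nat -> INR k + x <> 0) ->
  sum1 (fun k => / INR k ^ 2 * / (INR k + x)) K = zetaK 2 K / x - gK K x / x ^ 2.
Proof.
  intros H0 Hx. unfold zetaK, gK, Rdiv.
  rewrite 2!(Rmult_comm (sum1 _ _)), <- 2!sum1_scal, <- sum1_minus. apply sum1_ext.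
  intros k Hk. pose proof (INR_gt0 k ltac:(lia)). field.
  split; [|split]; [apply Hx, Hk|lra|exact H0].
Qed.

Lemma zetaK_gt0 (p K : nat) : (1 <= K)%nat -> 0 < zetaK p K.
Proof.
  intros H. assert (Hp : forall k, (1 <= k <= K)%nat -> 0 < / INR k ^ p).
  { intros k Hk. apply Rinv_0_lt_compat, pow_lt, INR_gt0. lia. }
  apply Rlt_le_trans with (/ INR 1 ^ p); [apply Hp; lia|].
  apply (sum1_ge_term (fun k => / INR k ^ p)); [intros; apply Rlt_le, Hp; lia|lia].
Qed.

(** The term [k = i] suffices, as [|i + x| < 1] in the gap. The bound is independent of [K] and
    [i]. *)
Lemma dgK_ge1 (K i : nat) (x : R) : (1 <= i <= K)%nat -> in_gap i x -> 1 <= dgK K x.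
Proof.
  intros Hi Hx. apply Rle_trans with (/ (INR i + x) ^ 2).
  - pose proof (in_gap_same_sign i i x x Hx Hx). destruct Hx.
    rewrite <- Rinv_1 at 1. apply Rinv_le_contravar; nra.
  - apply (sum1_ge_term (fun k => / (INR k + x) ^ 2)); [|exact Hi].
    intros k Hk. apply Rlt_le, Rinv_0_lt_compat. pose proof (in_gap_same_sign i k x x Hx Hx). nra.
Qed.

Section FinitePartialFractions.

Variables (m : nat) (z : nat -> R).
Hypothesis z_gap : forall i, (1 <= i <= m)%nat -> in_gap i (z i).
Hypothesis z_root : forall i, (1 <= i <= m)%nat -> gK (S m) (z i) = 0.

(* All [K = m + 1] zeros of [gK K], the zero at the origin carrying the index [K]. *)
Let zt (i : nat) : R := if Nat.eqb i (S m) then 0 else z i.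

Let zt_small (i : nat) : (1 <= i <= m)%nat -> zt i = z i.
Proof. intros Hi. unfold zt. destruct (Nat.eqb_spec i (S m)); [lia|reflexivity]. Qed.

Let zt_last : zt (S m) = 0.
Proof. unfold zt. rewrite Nat.eqb_refl. reflexivity. Qed.

Let zt_neq (i k : nat) : (1 <= i <= S m)%nat -> (1 <= k)%nat -> INR k + zt i <> 0.
Proof.
  intros Hi Hk. destruct (Nat.eq_dec i (S m)) as [->|Hne].
  - rewrite zt_last. pose proof (INR_gt0 k Hk). lra.
  - rewrite zt_small by lia. apply in_gap_neq0 with i, z_gap. lia.
Qed.

Let zt_inj (i j : nat) : (1 <= i <= S m)%nat -> (1 <= j <= S m)%nat -> i <> j -> zt i <> zt j.
Proof.
  assert (W : forall i j, (1 <= i < j)%nat -> (j <= S m)%nat -> zt i <> zt j).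
  { intros a b Hab Hb. rewrite (zt_small a) by lia. destruct (z_gap a ltac:(lia)) as [H1 H2].
    pose proof (INR_gt0 a ltac:(lia)).
    destruct (Nat.eq_dec b (S m)) as [->|Hne]; [rewrite zt_last; lra|].
    rewrite (zt_small b) by lia. destruct (z_gap b ltac:(lia)) as [H3 H4].
    assert (H5 : INR (S a) <= INR b) by (apply le_INR; lia). rewrite S_INR in H5. lra. }
  intros Hi Hj Hne. destruct (Nat.lt_total i j) as [L|[E|L]]; [|lia|].
  - apply W; lia.
  - apply not_eq_sym, W; lia.
Qed.

Let zt_root (i : nat) : (1 <= i <= S m)%nat -> gK (S m) (zt i) = 0.
Proof.
  intros Hi. destruct (Nat.eq_dec i (S m)) as [->|Hne].
  - rewrite zt_last. apply gK_0.
  - rewrite zt_small by lia. apply z_root. lia.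
Qed.

Let dgK_zt_last : dgK (S m) (zt (S m)) = zetaK 2 (S m).
Proof. rewrite zt_last. apply sum1_ext. intros k Hk. rewrite Rplus_0_r. reflexivity. Qed.

(* The vectors [1/(k + z)], [z] a zero of [gK K], are orthogonal because
   [gK z - gK z' = (z - z') * sum 1/((k + z)(k + z'))], and their squared norms are [gK' z]. *)
Let zt_parseval (p q : nat -> R) :
  sum1 (fun k => p k * q k) (S m)
  = sum1 (fun i => sum1 (fun k => p k * / (INR k + zt i)) (S m)
                   * sum1 (fun k => q k * / (INR k + zt i)) (S m) / dgK (S m) (zt i)) (S m).
Proof.
  apply (parseval (S m) (fun i k => / (INR k + zt i)) (fun i => dgK (S m) (zt i))).
  - intros i Hi. destruct (Nat.eq_dec i (S m)) as [->|Hne].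
    + rewrite dgK_zt_last. apply Rgt_not_eq, zetaK_gt0. lia.
    + rewrite zt_small by lia. pose proof (dgK_ge1 (S m) i (z i) ltac:(lia) (z_gap i ltac:(lia))). lra.
  - intros i j Hi Hj. destruct (Nat.eqb_spec i j) as [->|Hne].
    + apply sum1_ext. intros k Hk. field. apply zt_neq; lia.
    + pose proof (gK_diff (S m) (zt i) (zt j)) as H.
      rewrite !zt_root in H by assumption.
      specialize (H (fun k Hk => zt_neq i k Hi (proj1 Hk)) (fun k Hk => zt_neq j k Hj (proj1 Hk))).
      pose proof (zt_inj i j Hi Hj Hne).
      apply Rmult_eq_reg_l with (zt i - zt j); [|lra]. rewrite <- H. ring.
Qed.

Let moment_small (i : nat) : (1 <= i <= m)%nat ->
  sum1 (fun k => / INR k ^ 2 * / (INR k + zt i)) (S m) = zetaK 2 (S m) / z i.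
Proof.
  intros Hi. rewrite zt_small by exact Hi. destruct (z_gap i Hi).
  pose proof (INR_gt0 i ltac:(lia)). rewrite zetaK_moment, z_root.
  - field. lra.
  - exact Hi.
  - lra.
  - intros k Hk. apply in_gap_neq0 with i, z_gap, Hi.
Qed.

Let moment_last :
  sum1 (fun k => / INR k ^ 2 * / (INR k + zt (S m))) (S m) = zetaK 3 (S m).
Proof.
  rewrite zt_last. apply sum1_ext. intros k Hk. pose proof (INR_gt0 k ltac:(lia)). field. lra.
Qed.

(* Parseval's identity for the vectors [1/k^2] and [1/(k + x)]. *)
Lemma partial_fractions (x : R) : 0 < x ->
  / (x * gK (S m) x)
  = / (zetaK 2 (S m) * x ^ 2) + zetaK 3 (S m) / (zetaK 2 (S m) ^ 2 * x)
    + sum1 (fun i => / (dgK (S m) (z i) * z i) * / (x - z i)) m.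
Proof.
  intros Hx. pose proof (zetaK_gt0 2 (S m) ltac:(lia)) as HA.
  assert (Hxk : forall k, (1 <= k <= S m)%nat -> INR k + x <> 0).
  { intros k Hk. pose proof (INR_gt0 k ltac:(lia)). lra. }
  assert (Hcross : forall i, (1 <= i <= S m)%nat -> x <> zt i ->
    sum1 (fun k => / (INR k + x) * / (INR k + zt i)) (S m) = gK (S m) x / (x - zt i)).
  { intros i Hi Hne. pose proof (gK_diff (S m) x (zt i) Hxk (fun k Hk => zt_neq i k Hi (proj1 Hk))) as H.
    rewrite zt_root, Rminus_0_r in H by exact Hi. rewrite H. field. lra. }
  assert (Hg : 0 < gK (S m) x).
  { apply Rlt_le_trans with (/ INR 1 - / (INR 1 + x)).
    - apply Rlt_0_minus, Rinv_lt_contravar; simpl; lra.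
    - apply (sum1_ge_term (fun k => / INR k - / (INR k + x))); [|lia].
      intros k Hk. pose proof (INR_gt0 k ltac:(lia)). apply Rge_le, Rge_minus, Rle_ge, Rinv_le_contravar; lra. }
  pose proof (zt_parseval (fun k => / INR k ^ 2) (fun k => / (INR k + x))) as HP.
  cbv beta in HP. rewrite zetaK_moment in HP by (assumption || lra).
  rewrite sum1_S, moment_last, Hcross, dgK_zt_last, zt_last in HP by (rewrite ?zt_last; lia || lra).
  rewrite (sum1_ext _ (fun i => zetaK 2 (S m) * gK (S m) x
     * (/ (dgK (S m) (z i) * z i) * / (x - z i)))) in HP.
  2:{ intros i Hi. destruct (z_gap i Hi). pose proof (INR_gt0 i ltac:(lia)).
      pose proof (dgK_ge1 (S m) i (z i) ltac:(lia) (z_gap i Hi)).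
      rewrite moment_small, Hcross, zt_small by (rewrite ?zt_small; lia || lra).
      field. lra. }
  rewrite sum1_scal in HP. set (T := sum1 _ m) in *.
  (* After this multiplication the claim is Parseval's identity with [g_K(x)/x^2] moved across; that
     term is the source of the double pole at 0. *)
  apply Rmult_eq_reg_l with (zetaK 2 (S m) * gK (S m) x); [|nra].
  rewrite (Rmult_plus_distr_l _ _ T).
  replace (zetaK 2 (S m) * gK (S m) x * T) with
    (zetaK 2 (S m) / x - gK (S m) x / x ^ 2
     - zetaK 3 (S m) * (gK (S m) x / (x - 0)) / zetaK 2 (S m)) by lra.
  field. lra.
Qed.

(* Parseval's identity for the squared norm of [1/k^2]. *)
Lemma partial_fractions_at0 :
  sum1 (fun i => / (dgK (S m) (z i) * z i) * / z i) m
  = zetaK 4 (S m) / zetaK 2 (S m) ^ 2 - zetaK 3 (S m) ^ 2 / zetaK 2 (S m) ^ 3.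
Proof.
  pose proof (zetaK_gt0 2 (S m) ltac:(lia)) as HA.
  pose proof (zt_parseval (fun k => / INR k ^ 2) (fun k => / INR k ^ 2)) as HP.
  cbv beta in HP.
  rewrite (sum1_ext (fun k => / INR k ^ 2 * / INR k ^ 2) (fun k => / INR k ^ 4)) in HP.
  2:{ intros k Hk. pose proof (INR_gt0 k ltac:(lia)). field. lra. }
  fold (zetaK 4 (S m)) in HP.
  rewrite sum1_S, moment_last, dgK_zt_last in HP.
  rewrite (sum1_ext _ (fun i => zetaK 2 (S m) ^ 2 * (/ (dgK (S m) (z i) * z i) * / z i))) in HP.
  2:{ intros i Hi. destruct (z_gap i Hi). pose proof (INR_gt0 i ltac:(lia)).
      pose proof (dgK_ge1 (S m) i (z i) ltac:(lia) (z_gap i Hi)).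
      rewrite moment_small, zt_small by lia. field. lra. }
  rewrite sum1_scal in HP. rewrite HP. field. lra.
Qed.

End FinitePartialFractions.

Lemma gK_continuous (K i : nat) (x : R) : in_gap i x -> continuity_pt (gK K) x.
Proof.
  intros Hx. apply derivable_continuous_pt. apply ex_derive_Reals_0.
  induction K as [|K IH].
  - apply ex_derive_const.
  - apply (ex_derive_plus (gK K) (fun x => / INR (S K) - / (INR (S K) + x))); [exact IH|].
    pose proof (in_gap_neq0 i (S K) x Hx). auto_derive. exact H.
Qed.

(** Near the two ends of the gap [gK] takes opposite signs, because the adjacent pole dominates. The
    condition [i < K] ensures that the pole [-(i+1)] is among those of [gK K]. The root comes in a
    sigma type so that a function of [K] and [i] can be extracted from it. *)
Lemma gK_root (K i : nat) : (1 <= i < K)%nat -> {x : R | in_gap i x /\ gK K x = 0}.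
Proof.
  intros Hi. set (e := / (4 * INR K + 4)).
  assert (HK : 1 <= INR K) by (apply (le_INR 1); lia).
  assert (He : 0 < e) by (apply Rinv_0_lt_compat; lra).
  assert (He4 : e < 1 / 2).
  { unfold e. apply Rmult_lt_reg_r with (4 * INR K + 4); [lra|]. rewrite Rinv_l by lra. lra. }
  assert (Hei : / e = 4 * INR K + 4) by (unfold e; apply Rinv_inv).
  pose proof (INR_gt0 i ltac:(lia)) as Hi0.
  assert (Hi1 : 1 <= INR i) by (apply (le_INR 1); lia).
  set (x0 := - INR i - 1 + e). set (x1 := - INR i - e).
  assert (G : forall t, x0 <= t <= x1 -> in_gap i t) by (intros t Ht; unfold in_gap, x0, x1 in *; lra).
  assert (Hlow : gK K x0 < 0).
  { apply Rle_lt_trans with (sum1 (fun k => 3 - (if Nat.eqb (S i) k then 4 * INR K + 4 else 0)) K).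
    - apply sum1_le. intros k Hk. pose proof (INR_gt0 k ltac:(lia)).
      assert (Hk1 : / INR k <= 1).
      { rewrite <- Rinv_1. apply Rinv_le_contravar; [lra|]. apply (le_INR 1). lia. }
      destruct (Nat.eqb_spec (S i) k) as [<-|Hne].
      + replace (INR (S i) + x0) with e by (rewrite S_INR; unfold x0; ring). rewrite Hei. lra.
      + destruct (le_lt_dec k i) as [L|L].
        * apply le_INR in L. assert (- / (INR k + x0) <= 2); [|lra].
          rewrite <- Rinv_opp. rewrite <- (Rinv_inv 2). apply Rinv_le_contravar; unfold x0; lra.
        * assert (0 < / (INR k + x0)); [|lra]. apply Rinv_0_lt_compat.
          assert (L2 : (S (S i) <= k)%nat) by lia. apply le_INR in L2. rewrite !S_INR in L2. unfold x0. lra.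
    - rewrite sum1_minus, sum1_const.
      rewrite (sum1_pick (fun _ => 4 * INR K + 4)) by lia. lra. }
  assert (Hhigh : 0 < gK K x1).
  { apply Rlt_le_trans with (sum1 (fun k => -2 + (if Nat.eqb i k then 4 * INR K + 4 else 0)) K).
    - rewrite sum1_plus, sum1_const.
      rewrite (sum1_pick (fun _ => 4 * INR K + 4)) by lia. lra.
    - apply sum1_le. intros k Hk. pose proof (INR_gt0 k ltac:(lia)).
      assert (Hk1 : 0 < / INR k) by (apply Rinv_0_lt_compat; lra).
      destruct (Nat.eqb_spec i k) as [<-|Hne].
      + replace (INR i + x1) with (- e) by (unfold x1; ring). rewrite Rinv_opp, Hei. lra.
      + destruct (le_lt_dec k i) as [L|L].
        * assert (/ (INR k + x1) < 0); [|lra]. apply Rinv_lt_0_compat.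
          apply le_INR in L. unfold x1. lra.
        * apply (le_INR (S i)) in L. rewrite S_INR in L.
          assert (/ (INR k + x1) <= 2); [|lra].
          rewrite <- (Rinv_inv 2). apply Rinv_le_contravar; unfold x1; lra. }
  destruct (IVT_interv (gK K) x0 x1) as [x [Hx1 Hx2]].
  - intros t Ht. apply gK_continuous with i, G, Ht.
  - unfold x0, x1. lra.
  - exact Hlow.
  - exact Hhigh.
  - exists x. split; [apply G, Hx1|exact Hx2].
Qed.

(** * Values of zeta *)

Lemma inv_sqr_tail (x : R) (n : nat) : 0 < x ->
  sum1 (fun k => / (x + INR k) ^ 2) n <= / x - / (x + INR n).
Proof.
  intros Hx. induction n as [|n IH].
  - simpl. rewrite Rplus_0_r. lra.
  - rewrite sum1_S, S_INR. pose proof (pos_INR n).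
    assert (/ (x + (INR n + 1)) ^ 2 <= / (x + INR n) - / (x + (INR n + 1))); [|lra].
    apply Rle_trans with (/ ((x + INR n) * (x + (INR n + 1)))).
    + apply Rinv_le_contravar; nra.
    + apply Req_le. field. lra.
Qed.

Lemma zetaK_le2 (p K : nat) : (2 <= p)%nat -> zetaK p K <= 2.
Proof.
  intros Hp. apply Rle_trans with (zetaK 2 K).
  - apply sum1_le. intros k Hk.
    assert (1 <= INR k) by (apply (le_INR 1); lia).
    apply Rinv_le_contravar; [apply pow_lt; lra|apply Rle_pow; assumption].
  - destruct K as [|K]; [unfold zetaK; simpl; lra|].
    unfold zetaK. rewrite sum1_first.
    rewrite (sum1_ext _ (fun k => / (1 + INR k) ^ 2)).
    2:{ intros k _. rewrite S_INR, Rplus_comm. reflexivity. }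
    pose proof (inv_sqr_tail 1 K ltac:(lra)). pose proof (pos_INR K).
    assert (0 < / (1 + INR K)) by (apply Rinv_0_lt_compat; lra). simpl (INR 1). lra.
Qed.

Lemma sum1_incr (f : nat -> R) (n : nat) : (forall k, 0 <= f (S k)) -> sum1 f n <= sum1 f (S n).
Proof. intros H. rewrite sum1_S. specialize (H n). lra. Qed.

Lemma zetaK_lim (p : nat) : (2 <= p)%nat -> is_lim_seq (zetaK p) (zeta p).
Proof.
  intros Hp.
  assert (E : forall n, zetaK p (S n) = sum_n (fun j => / (INR j + 1) ^ p) n).
  { intros n. induction n as [|n IH].
    - rewrite sum_O. unfold zetaK. simpl. rewrite !Rplus_0_l. reflexivity.
    - rewrite sum_Sn, <- IH, <- S_INR. reflexivity. }
  assert (Hex : ex_finite_lim_seq (zetaK p)).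
  { apply ex_finite_lim_seq_incr with 2.
    - intros n. apply sum1_incr. intros k. apply Rlt_le, Rinv_0_lt_compat, pow_lt, INR_gt0. lia.
    - intros n. apply zetaK_le2, Hp. }
  destruct Hex as [l Hl]. replace (zeta p) with l; [exact Hl|].
  symmetry. apply is_series_unique.
  change (is_lim_seq (sum_n (fun j => / (INR j + 1) ^ p)) l).
  apply is_lim_seq_ext with (fun n => zetaK p (S n)); [exact E|].
  apply -> is_lim_seq_incr_1. exact Hl.
Qed.

(** * Trigonometric sums evaluating [zeta(2)] and [zeta(4)] *)

Lemma x_cos_le_sin (x : R) : 0 < x < PI / 2 -> x * cos x <= sin x.
Proof.
  intros [H0 H1].
  destruct (MVT_gen (fun t => sin t - t * cos t) 0 x (fun t => t * sin t)) as [c [Hc E]].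
  - intros t _. auto_derive; [exact I|ring].
  - intros t _. apply derivable_continuous_pt, ex_derive_Reals_0. auto_derive. exact I.
  - rewrite Rmin_left, Rmax_right in Hc by lra. rewrite sin_0 in E.
    assert (0 <= sin c) by (apply sin_ge_0; lra).
    assert (0 <= c * sin c * (x - 0)) by (apply Rmult_le_pos; [apply Rmult_le_pos|]; lra).
    lra.
Qed.

(** The squares of [cot x <= 1/x <= 1/sin x]. Summed over equally spaced angles, they squeeze
    partial sums of zeta between finite sums known in closed form. *)
Lemma inv_sqr_sin_bounds (x : R) : 0 < x < PI / 2 -> / sin x ^ 2 - 1 <= / x ^ 2 <= / sin x ^ 2.
Proof.
  intros Hx. assert (Hs : 0 < sin x) by (apply sin_gt_0; lra).
  assert (Hc : 0 < cos x) by (apply cos_gt_0; lra).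
  pose proof (sin_lt_x x (proj1 Hx)). pose proof (x_cos_le_sin x Hx). split.
  - replace (/ sin x ^ 2 - 1) with (cos x ^ 2 / sin x ^ 2).
    2:{ pose proof (sin2_cos2 x) as Hsc. unfold Rsqr in Hsc.
        replace (cos x ^ 2) with (1 - sin x ^ 2) by (simpl; lra). field. lra. }
    apply Rmult_le_reg_r with (x ^ 2 * sin x ^ 2); [apply Rmult_lt_0_compat; apply pow_lt; lra|].
    replace (cos x ^ 2 / sin x ^ 2 * (x ^ 2 * sin x ^ 2)) with ((x * cos x) ^ 2) by (field; lra).
    replace (/ x ^ 2 * (x ^ 2 * sin x ^ 2)) with (sin x ^ 2) by (field; lra).
    apply pow_incr. split; [apply Rmult_le_pos; lra|assumption].
  - apply Rinv_le_contravar; [apply pow_lt; lra|]. apply pow_incr. lra.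
Qed.

Lemma sum1_fold (f : nat -> R) (M : nat) : (1 <= M)%nat ->
  sum1 f (2 * M - 1) = sum1 (fun k => f k + f (2 * M - k)%nat) (M - 1) + f M.
Proof.
  intros HM. replace (2 * M - 1)%nat with (S (M - 1) + (M - 1))%nat by lia.
  rewrite sum1_app, sum1_S, sum1_plus. replace (S (M - 1)) with M by lia.
  rewrite (sum1_rev (fun k => f (M + k)%nat)).
  rewrite (sum1_ext (fun k => f (M + (S (M - 1) - k))%nat) (fun k => f (2 * M - k)%nat)); [ring|].
  intros k Hk. f_equal. lia.
Qed.

(* The doubling formulas for [1/sin^2 + 1/cos^2] and [1/sin^4 + 1/cos^4] give recurrences in [n]
   for the sums of [1/sin^2] and [1/sin^4] over these angles. *)
Definition angle (n k : nat) : R := INR k * PI / 2 ^ S n.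

Definition csc_sum (p n : nat) : R := sum1 (fun k => / sin (angle n k) ^ p) (2 ^ n - 1).

Lemma INR_pow2 (n : nat) : INR (2 ^ n) = 2 ^ n.
Proof. rewrite pow_INR. reflexivity. Qed.

Lemma angle_bounds (n k : nat) : (1 <= k <= 2 ^ n - 1)%nat -> 0 < angle n k < PI / 2.
Proof.
  intros Hk. unfold angle. pose proof PI_RGT_0. pose proof (pow_lt 2 n ltac:(lra)).
  assert (0 < INR k) by (apply INR_gt0; lia).
  assert (INR k < 2 ^ n) by (rewrite <- INR_pow2; apply lt_INR; lia).
  change (2 ^ S n) with (2 * 2 ^ n). split.
  - apply Rmult_lt_0_compat; [nra|apply Rinv_0_lt_compat; lra].
  - apply Rmult_lt_reg_r with (2 * 2 ^ n); [lra|].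
    replace (INR k * PI / (2 * 2 ^ n) * (2 * 2 ^ n)) with (INR k * PI) by (field; lra). nra.
Qed.

(** The indices [k] and [2^(n+1) - k] belong to complementary angles, so folding the sum pairs a
    sine with the cosine of the same half angle; the unpaired middle index gives [PI/4]. *)
Lemma csc_sum_succ (p n : nat) :
  csc_sum p (S n)
  = sum1 (fun k => / sin (angle n k / 2) ^ p + / cos (angle n k / 2) ^ p) (2 ^ n - 1)
    + / sin (PI / 4) ^ p.
Proof.
  unfold csc_sum. pose proof (pow_lt 2 n ltac:(lra)).
  change (2 ^ S n)%nat with (2 * 2 ^ n)%nat.
  rewrite sum1_fold by (apply Nat.neq_0_lt_0, Nat.pow_nonzero; lia).
  f_equal.
  - apply sum1_ext. intros k Hk.
    assert (E : angle (S n) k = angle n k / 2).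
    { unfold angle. simpl. field. lra. }
    rewrite E. f_equal. rewrite <- sin_shift. do 3 f_equal. rewrite <- E. unfold angle.
    rewrite minus_INR, mult_INR, INR_pow2 by lia. simpl. field. lra.
  - do 3 f_equal. unfold angle. rewrite INR_pow2. simpl. field. lra.
Qed.

Lemma sin_PI4_sqr : sin (PI / 4) ^ 2 = 1 / 2.
Proof.
  pose proof (cos_2a_sin (PI / 4)) as H. replace (2 * (PI / 4)) with (PI / 2) in H by field.
  rewrite cos_PI2 in H. lra.
Qed.

Lemma half_angle (n k : nat) : (1 <= k <= 2 ^ n - 1)%nat ->
  exists s c, 0 < s /\ 0 < c /\ s ^ 2 + c ^ 2 = 1 /\ sin (angle n k / 2) = s
    /\ cos (angle n k / 2) = c /\ sin (angle n k) = 2 * s * c.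
Proof.
  intros Hk. pose proof (angle_bounds n k Hk). set (y := angle n k / 2).
  exists (sin y), (cos y).
  assert (0 < sin y) by (apply sin_gt_0; unfold y; lra).
  assert (0 < cos y) by (apply cos_gt_0; unfold y; lra).
  pose proof (sin2_cos2 y) as E. unfold Rsqr in E.
  repeat split; try assumption; [lra|]. rewrite <- sin_2a. f_equal. unfold y. field.
Qed.

(** The recurrence is [a_(n+1) = 4 a_n + 2], the 2 coming from the middle angle. *)
Lemma csc_sum2 (n : nat) : csc_sum 2 n = 2 / 3 * (4 ^ n - 1).
Proof.
  induction n as [|n IH]; [unfold csc_sum; simpl; lra|].
  rewrite csc_sum_succ, sin_PI4_sqr.
  rewrite (sum1_ext _ (fun k => 4 * / sin (angle n k) ^ 2)).
  2:{ intros k Hk. destruct (half_angle n k Hk) as (s & c & Hs & Hc & E & -> & -> & ->).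
      transitivity ((s ^ 2 + c ^ 2) / (s ^ 2 * c ^ 2)); [field; lra|]. rewrite E. field. lra. }
  rewrite sum1_scal. fold (csc_sum 2 n). rewrite IH. simpl. field.
Qed.

(** The recurrence is [b_(n+1) = 16 b_n - 8 a_n + 4], with [a_n] the sum of the inverse squares.
    Only the coefficient [8/45] survives in the limit: [(8/45) PI^4/16 = PI^4/90]. *)
Lemma csc_sum4 (n : nat) : csc_sum 4 n = 8 / 45 * 16 ^ n + 4 / 9 * 4 ^ n - 28 / 45.
Proof.
  induction n as [|n IH]; [unfold csc_sum; simpl; lra|].
  rewrite csc_sum_succ. replace (sin (PI / 4) ^ 4) with ((sin (PI / 4) ^ 2) ^ 2) by ring.
  rewrite sin_PI4_sqr.
  rewrite (sum1_ext _ (fun k => 16 * / sin (angle n k) ^ 4 - 8 * / sin (angle n k) ^ 2)).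
  2:{ intros k Hk. destruct (half_angle n k Hk) as (s & c & Hs & Hc & E & -> & -> & ->).
      transitivity (((s ^ 2 + c ^ 2) ^ 2 - 2 * s ^ 2 * c ^ 2) / (s ^ 4 * c ^ 4)); [field; lra|].
      rewrite E. field. lra. }
  rewrite sum1_minus, !sum1_scal. fold (csc_sum 4 n). fold (csc_sum 2 n).
  rewrite IH, csc_sum2. simpl. field.
Qed.

Lemma zetaK_angle (p n : nat) :
  sum1 (fun k => / angle n k ^ p) (2 ^ n - 1) = (2 ^ S n / PI) ^ p * zetaK p (2 ^ n - 1).
Proof.
  unfold zetaK. rewrite <- sum1_scal. apply sum1_ext. intros k Hk.
  pose proof PI_RGT_0. pose proof (pow_lt 2 (S n) ltac:(lra)). pose proof (INR_gt0 k ltac:(lia)).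
  rewrite <- !pow_inv, <- Rpow_mult_distr. f_equal. unfold angle. field. lra.
Qed.

Lemma is_lim_seq_zetaK_pow2 (p : nat) : (2 <= p)%nat ->
  is_lim_seq (fun n => zetaK p (2 ^ n - 1)) (zeta p).
Proof.
  intros Hp. apply (is_lim_seq_subseq (zetaK p) _ (fun n => (2 ^ n - 1)%nat)); [|apply zetaK_lim, Hp].
  intros P [N HN]. exists N. intros n Hn. apply HN.
  pose proof (Nat.pow_gt_lin_r 2 n ltac:(lia)). lia.
Qed.

Lemma zeta2_eq : zeta 2 = PI ^ 2 / 6.
Proof.
  pose proof PI_RGT_0.
  assert (B : forall n, csc_sum 2 n - 2 ^ n <= (2 ^ S n / PI) ^ 2 * zetaK 2 (2 ^ n - 1) <= csc_sum 2 n).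
  { intros n. rewrite <- zetaK_angle. split.
    - apply Rle_trans with (csc_sum 2 n - sum1 (fun _ => 1) (2 ^ n - 1)).
      + rewrite sum1_const, minus_INR, INR_pow2.
        * simpl (INR 1). lra.
        * apply Nat.neq_0_lt_0, Nat.pow_nonzero. lia.
      + unfold csc_sum. rewrite <- sum1_minus. apply sum1_le. intros k Hk.
        apply inv_sqr_sin_bounds, angle_bounds, Hk.
    - apply sum1_le. intros k Hk. apply inv_sqr_sin_bounds, angle_bounds, Hk. }
  (* The two bounds are those of [B] divided by [(2^(n+1)/PI)^2]; the number of angles is of order
     [2^n], negligible against [4^n]. *)
  assert (L : is_lim_seq (fun n => zetaK 2 (2 ^ n - 1)) (PI ^ 2 / 6)).
  { apply is_lim_seq_le_le with
      (u := fun n => PI ^ 2 / 4 * (2 / 3 - 2 / 3 * (/ 4) ^ n - (/ 2) ^ n))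
      (w := fun n => PI ^ 2 / 4 * (2 / 3 - 2 / 3 * (/ 4) ^ n)).
    - intros n. specialize (B n). rewrite csc_sum2 in B.
      assert (H4 : 0 < 4 ^ n) by (apply pow_lt; lra). assert (H2 : 0 < 2 ^ n) by (apply pow_lt; lra).
      assert (E : 4 ^ n = 2 ^ n * 2 ^ n) by (rewrite <- Rpow_mult_distr; f_equal; lra).
      rewrite !pow_inv. rewrite E in *.
      replace ((2 ^ S n / PI) ^ 2) with (4 * (2 ^ n * 2 ^ n) / PI ^ 2) in B by (simpl; field; lra).
      assert (HP : 0 < 4 * (2 ^ n * 2 ^ n) / PI ^ 2).
      { apply Rmult_lt_0_compat; [lra|]. apply Rinv_0_lt_compat, pow_lt. lra. }
      split; apply Rmult_le_reg_l with (4 * (2 ^ n * 2 ^ n) / PI ^ 2); try exact HP.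
      + eapply Rle_trans; [|apply B]. apply Req_le. field. lra.
      + eapply Rle_trans; [apply B|]. apply Req_le. field. lra.
    - replace (PI ^ 2 / 6) with (PI ^ 2 / 4 * (2 / 3 - 2 / 3 * 0 - 0)) by field.
      apply (is_lim_seq_scal_l _ (PI ^ 2 / 4) (Finite (2 / 3 - 2 / 3 * 0 - 0))).
      apply is_lim_seq_minus'; [apply is_lim_seq_minus'; [apply is_lim_seq_const|]|].
      + apply (is_lim_seq_scal_l _ (2 / 3) 0). apply is_lim_seq_geom. rewrite Rabs_pos_eq; lra.
      + apply is_lim_seq_geom. rewrite Rabs_pos_eq; lra.
    - replace (PI ^ 2 / 6) with (PI ^ 2 / 4 * (2 / 3 - 2 / 3 * 0)) by field.
      apply (is_lim_seq_scal_l _ (PI ^ 2 / 4) (Finite (2 / 3 - 2 / 3 * 0))).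
      apply is_lim_seq_minus'; [apply is_lim_seq_const|].
      apply (is_lim_seq_scal_l _ (2 / 3) 0). apply is_lim_seq_geom. rewrite Rabs_pos_eq; lra. }
  pose proof (is_lim_seq_unique _ _ L) as E1.
  pose proof (is_lim_seq_unique _ _ (is_lim_seq_zetaK_pow2 2 ltac:(lia))) as E2.
  rewrite E1 in E2. injection E2. auto.
Qed.

Lemma zeta4_eq : zeta 4 = PI ^ 4 / 90.
Proof.
  pose proof PI_RGT_0.
  (* The lower bound squares [1/sin^2 - 1 <= 1/x^2] and drops the 1. *)
  assert (B : forall n, csc_sum 4 n - 2 * csc_sum 2 n <= (2 ^ S n / PI) ^ 4 * zetaK 4 (2 ^ n - 1) <= csc_sum 4 n).
  { intros n. rewrite <- zetaK_angle. unfold csc_sum. rewrite <- sum1_scal, <- sum1_minus.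
    split; apply sum1_le; intros k Hk; pose proof (angle_bounds n k Hk) as Ha;
      pose proof (inv_sqr_sin_bounds _ Ha) as [H1 H2];
      rewrite <- !pow_inv in *; set (s := / sin (angle n k)) in *;
      assert (Hx : 0 < / angle n k) by (apply Rinv_0_lt_compat, Ha); set (x := / angle n k) in *;
      replace (x ^ 4) with (x ^ 2 * x ^ 2) by ring; replace (s ^ 4) with (s ^ 2 * s ^ 2) by ring;
      assert (0 < x ^ 2) by (apply pow_lt, Hx); nra. }
  assert (L : is_lim_seq (fun n => zetaK 4 (2 ^ n - 1)) (PI ^ 4 / 90)).
  { apply is_lim_seq_le_le with
      (u := fun n => PI ^ 4 / 16 * (8 / 45 - 8 / 9 * (/ 4) ^ n + 32 / 45 * (/ 16) ^ n))
      (w := fun n => PI ^ 4 / 16 * (8 / 45 + 4 / 9 * (/ 4) ^ n - 28 / 45 * (/ 16) ^ n)).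
    - intros n. specialize (B n). rewrite csc_sum2, csc_sum4 in B.
      assert (H2 : 0 < 2 ^ n) by (apply pow_lt; lra).
      assert (E : 4 ^ n = (2 ^ n) ^ 2) by (rewrite <- pow_mult, Nat.mul_comm, pow_mult; f_equal; lra).
      assert (E' : 16 ^ n = (2 ^ n) ^ 4) by (rewrite <- pow_mult, Nat.mul_comm, pow_mult; f_equal; lra).
      rewrite !pow_inv. rewrite E, E' in *.
      replace ((2 ^ S n / PI) ^ 4) with (16 * (2 ^ n) ^ 4 / PI ^ 4) in B by (simpl; field; lra).
      assert (HP : 0 < 16 * (2 ^ n) ^ 4 / PI ^ 4).
      { pose proof (pow_lt (2 ^ n) 4 H2). apply Rmult_lt_0_compat; [lra|]. apply Rinv_0_lt_compat, pow_lt. lra. }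
      split; apply Rmult_le_reg_l with (16 * (2 ^ n) ^ 4 / PI ^ 4); try exact HP.
      + eapply Rle_trans; [|apply B]. assert (0 < (2 ^ n) ^ 2) by (apply pow_lt; lra).
        match goal with |- ?l <= ?r => assert (l = r); [field; lra|lra] end.
      + eapply Rle_trans; [apply B|]. apply Req_le. field. lra.
    - replace (PI ^ 4 / 90) with (PI ^ 4 / 16 * (8 / 45 - 8 / 9 * 0 + 32 / 45 * 0)) by field.
      apply (is_lim_seq_scal_l _ (PI ^ 4 / 16) (Finite (8 / 45 - 8 / 9 * 0 + 32 / 45 * 0))).
      apply is_lim_seq_plus'; [apply is_lim_seq_minus'; [apply is_lim_seq_const|]|].
      + apply (is_lim_seq_scal_l _ (8 / 9) 0). apply is_lim_seq_geom. rewrite Rabs_pos_eq; lra.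
      + apply (is_lim_seq_scal_l _ (32 / 45) 0). apply is_lim_seq_geom. rewrite Rabs_pos_eq; lra.
    - replace (PI ^ 4 / 90) with (PI ^ 4 / 16 * (8 / 45 + 4 / 9 * 0 - 28 / 45 * 0)) by field.
      apply (is_lim_seq_scal_l _ (PI ^ 4 / 16) (Finite (8 / 45 + 4 / 9 * 0 - 28 / 45 * 0))).
      apply is_lim_seq_minus'; [apply is_lim_seq_plus'; [apply is_lim_seq_const|]|].
      + apply (is_lim_seq_scal_l _ (4 / 9) 0). apply is_lim_seq_geom. rewrite Rabs_pos_eq; lra.
      + apply (is_lim_seq_scal_l _ (28 / 45) 0). apply is_lim_seq_geom. rewrite Rabs_pos_eq; lra. }
  pose proof (is_lim_seq_unique _ _ L) as E1.
  pose proof (is_lim_seq_unique _ _ (is_lim_seq_zetaK_pow2 4 ltac:(lia))) as E2.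
  rewrite E1 in E2. injection E2. auto.
Qed.

(** * The Gamma function *)

(** A quadratic Taylor remainder with a constant independent of [n] passes to the pointwise limit.
    Convergence of the derivatives is then required only at the point [x] itself. *)
Lemma is_derive_of_limits (f d : nat -> R -> R) (F : R -> R) (x D M r : R) : 0 < r ->
  (forall y, Rabs (y - x) < r -> is_lim_seq (fun n => f n y) (F y)) ->
  is_lim_seq (fun n => d n x) D ->
  (forall n y, Rabs (y - x) < r -> Rabs (f n y - f n x - (y - x) * d n x) <= M * (y - x) ^ 2) ->
  is_derive F x D.
Proof.
  intros Hr Hf Hd HM.
  assert (HF : forall y, Rabs (y - x) < r -> Rabs (F y - F x - (y - x) * D) <= M * (y - x) ^ 2).
  { intros y Hy.
    apply (is_lim_seq_le (fun n => Rabs (f n y - f n x - (y - x) * d n x)) (fun _ => M * (y - x) ^ 2)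
             (Rabs (F y - F x - (y - x) * D)) (M * (y - x) ^ 2)).
    - intros n. apply HM, Hy.
    - apply (is_lim_seq_abs _ (F y - F x - (y - x) * D)).
      apply is_lim_seq_minus'; [apply is_lim_seq_minus'|].
      + apply Hf, Hy.
      + apply Hf. rewrite Rminus_diag, Rabs_R0. exact Hr.
      + apply (is_lim_seq_scal_l _ (y - x) D). exact Hd.
    - apply is_lim_seq_const. }
  apply is_derive_Reals. intros e He.
  (* [M] carries no sign condition; [|M| + 1] is a positive substitute to divide by. *)
  assert (HM1 : 0 < Rabs M + 1) by (pose proof (Rabs_pos M); lra).
  assert (Hdel : 0 < Rmin r (e / (Rabs M + 1))).
  { apply Rmin_pos; [exact Hr|]. apply Rdiv_lt_0_compat; lra. }
  exists (mkposreal _ Hdel). intros h Hh0 Hh. simpl in Hh.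
  assert (Hhr : Rabs h < r) by (eapply Rlt_le_trans; [exact Hh|apply Rmin_l]).
  assert (Hhe : Rabs h < e / (Rabs M + 1)) by (eapply Rlt_le_trans; [exact Hh|apply Rmin_r]).
  specialize (HF (x + h)). replace (x + h - x) with h in HF by ring. specialize (HF Hhr).
  replace ((F (x + h) - F x) / h - D) with ((F (x + h) - F x - h * D) / h) by (field; exact Hh0).
  assert (Hah : 0 < Rabs h) by (apply Rabs_pos_lt, Hh0).
  unfold Rdiv. rewrite Rabs_mult, Rabs_inv.
  apply Rmult_lt_reg_r with (Rabs h); [exact Hah|].
  rewrite Rmult_assoc, Rinv_l, Rmult_1_r by lra.
  eapply Rle_lt_trans; [exact HF|].
  rewrite <- (pow2_abs h).
  assert (Rabs h * (Rabs M + 1) < e).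
  { apply Rmult_lt_compat_r with (r := Rabs M + 1) in Hhe; [|exact HM1].
    replace (e / (Rabs M + 1) * (Rabs M + 1)) with e in Hhe by (field; lra). exact Hhe. }
  pose proof (Rle_abs M). nra.
Qed.

Lemma ln_le_minus1 (t : R) : 0 < t -> ln t <= t - 1.
Proof. intros Ht. pose proof (exp_ineq1_le (ln t)) as H. rewrite exp_ln in H by exact Ht. lra. Qed.

Lemma ln_ge_1_minus_inv (t : R) : 0 < t -> 1 - / t <= ln t.
Proof.
  intros Ht. pose proof (ln_le_minus1 (/ t) (Rinv_0_lt_compat t Ht)) as H.
  rewrite ln_Rinv in H by exact Ht. lra.
Qed.

Lemma ln_diff_bounds (t h : R) : 0 < t -> 0 < t + h -> h / (t + h) <= ln (t + h) - ln t <= h / t.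
Proof.
  intros Ht Hth. rewrite <- ln_div by assumption.
  assert (Hq : 0 < (t + h) / t) by (apply Rdiv_lt_0_compat; assumption). split.
  - eapply Rle_trans; [|apply ln_ge_1_minus_inv, Hq]. apply Req_le. field. lra.
  - eapply Rle_trans; [apply ln_le_minus1, Hq|]. apply Req_le. field. lra.
Qed.

Definition psum (phi : R -> R) (n : nat) (x : R) : R :=
  phi x + sum1 (fun k => phi (x + INR k)) n.

Lemma psum_shift (phi : R -> R) (n : nat) (x : R) :
  psum phi n x = phi x + psum phi n (x + 1) - phi (x + INR n + 1).
Proof.
  induction n as [|n IH].
  - unfold psum. simpl. rewrite (Rplus_0_r x). ring.
  - unfold psum in *. rewrite !sum1_S.
    replace (x + 1 + INR (S n)) with (x + INR (S n) + 1) by ring.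
    replace (x + INR n + 1) with (x + INR (S n)) in IH by (rewrite S_INR; ring). lra.
Qed.

(** Termwise remainders of size [c/t^2] add up to [c] times a convergent sum, which provides the
    bound uniform in [n] that differentiation of the limit requires. *)
Lemma psum_taylor (phi dphi : R -> R) (n : nat) (x h c : R) : 0 < x ->
  (forall t, x <= t -> Rabs (phi (t + h) - phi t - h * dphi t) <= c * / t ^ 2) ->
  Rabs (psum phi n (x + h) - psum phi n x - h * psum dphi n x) <= c * psum (fun t => / t ^ 2) n x.
Proof.
  intros Hx H. induction n as [|n IH].
  - unfold psum. simpl sum1. rewrite !Rplus_0_r. apply H. lra.
  - unfold psum in *. rewrite !sum1_S.
    pose proof (pos_INR (S n)). specialize (H (x + INR (S n)) ltac:(lra)).
    replace (x + h + INR (S n)) with (x + INR (S n) + h) by ring.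
    match goal with |- Rabs ?e <= _ => match type of IH with Rabs ?a <= _ => match type of H with Rabs ?b <= _ =>
      replace e with (a + b) by ring end end end.
    eapply Rle_trans; [apply Rabs_triang|]. lra.
Qed.

(** For [x > 0], [lgN] is the logarithm of Gauss's product [gauss], and [digN] and [trigN] are its
    first and second derivatives. The formulas of [digN] and [trigN] keep their meaning at negative
    non-integers, where the logarithm does not. *)
Definition digN (n : nat) (x : R) : R := ln (INR n) - psum Rinv n x.
Definition trigN (n : nat) (x : R) : R := psum (fun t => / t ^ 2) n x.
Definition lgN (n : nat) (x : R) : R := ln (INR (fact n)) + x * ln (INR n) - psum ln n x.
Definition gauss (n : nat) (x : R) : R := INR (fact n) * Rpower (INR n) x / pochn x n.
Definition digamma (x : R) : R := real (Lim_seq (fun n => digN n x)).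
Definition trigamma (x : R) : R := real (Lim_seq (fun n => trigN n x)).
Definition lgamma (x : R) : R := real (Lim_seq (fun n => lgN n x)).

Lemma gauss_exp (n : nat) (x : R) : 0 < x -> gauss n x = exp (lgN n x).
Proof.
  intros Hx. unfold gauss, lgN, Rminus, Rdiv. rewrite !exp_plus, exp_Ropp.
  rewrite exp_ln by apply INR_fact_lt_0. unfold Rpower. f_equal. f_equal.
  induction n as [|n IH].
  - unfold psum. simpl. rewrite Rplus_0_r, exp_ln; auto.
  - change (pochn x (S n)) with (pochn x n * (x + INR (S n))). rewrite IH.
    unfold psum. rewrite sum1_S, <- Rplus_assoc, (exp_plus _ (ln (x + INR (S n)))), exp_ln; [reflexivity|].
    pose proof (pos_INR (S n)). lra.
Qed.

Lemma is_lim_seq_real (u : nat -> R) : ex_finite_lim_seq u -> is_lim_seq u (real (Lim_seq u)).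
Proof. intros H. apply Lim_seq_correct', H. Qed.

Lemma ex_finite_lim_seq_shift (u : nat -> R) :
  ex_finite_lim_seq (fun n => u (S n)) -> ex_finite_lim_seq u.
Proof. intros [l Hl]. exists l. apply is_lim_seq_incr_1, Hl. Qed.

Lemma lgN_lim (x : R) : 0 < x -> is_lim_seq (fun n => lgN n x) (lgamma x).
Proof.
  intros Hx. apply is_lim_seq_real, ex_finite_lim_seq_shift.
  (* Both parts of the increment are [x/(n+2)] to first order. Their difference is nonnegative and
     bounded by a telescoping term, so the sequence is increasing and bounded; starting at index 1
     avoids [ln 0]. *)
  assert (D : forall n, 0 <= lgN (S (S n)) x - lgN (S n) x
     <= x * (x + 1) * (/ INR (S n) - / INR (S (S n)))).
  { intros n. assert (HN : 0 < INR (S n)) by (apply INR_gt0; lia).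
    assert (E : lgN (S (S n)) x - lgN (S n) x
      = x * (ln (INR (S n) + 1) - ln (INR (S n)))
        - (ln (INR (S n) + 1 + x) - ln (INR (S n) + 1))).
    { unfold lgN, psum. rewrite (sum1_S _ (S n)), (S_INR (S n)).
      change (fact (S (S n))) with (S (S n) * fact (S n))%nat.
      rewrite mult_INR, ln_mult, (S_INR (S n)).
      - replace (x + (INR (S n) + 1)) with (INR (S n) + 1 + x) by ring. ring.
      - apply INR_gt0. lia.
      - apply INR_fact_lt_0. }
    rewrite E, (S_INR (S n)). set (N := INR (S n)) in *.
    destruct (ln_diff_bounds N 1 HN ltac:(lra)) as [A1 A2].
    destruct (ln_diff_bounds (N + 1) x ltac:(lra) ltac:(lra)) as [B1 B2].
    apply Rmult_le_compat_l with (r := x) in A1; [|lra].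
    apply Rmult_le_compat_l with (r := x) in A2; [|lra].
    replace (x * (1 / (N + 1))) with (x / (N + 1)) in A1 by (field; lra). split; [lra|].
    apply Rle_trans with (x * (1 / N) - x / (N + 1 + x)); [lra|].
    replace (x * (1 / N) - x / (N + 1 + x)) with (x * (x + 1) * / (N * (N + 1 + x))) by (field; lra).
    replace (/ N - / (N + 1)) with (/ (N * (N + 1))) by (field; lra).
    apply Rmult_le_compat_l; [nra|]. apply Rinv_le_contravar; nra. }
  apply ex_finite_lim_seq_incr with (lgN 1 x + x * (x + 1)).
  - intros n. specialize (D n). lra.
  - assert (B : forall n, lgN (S n) x <= lgN 1 x + x * (x + 1) * (1 - / INR (S n))).
    { induction n as [|n IH]; [simpl (INR 1); lra|]. specialize (D n). lra. }
    intros n. specialize (B n). assert (0 < / INR (S n)) by (apply Rinv_0_lt_compat, INR_gt0; lia).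
    assert (0 < x * (x + 1) * / INR (S n)) by (apply Rmult_lt_0_compat; nra). lra.
Qed.

Lemma harm_minus_ln_decr (n : nat) : (1 <= n)%nat ->
  harm (S n) - ln (INR (S n)) <= harm n - ln (INR n).
Proof.
  intros Hn. unfold harm. rewrite sum1_S, S_INR. pose proof (INR_gt0 n Hn).
  pose proof (ln_diff_bounds (INR n) 1 ltac:(lra) ltac:(lra)).
  replace (1 / (INR n + 1)) with (/ (INR n + 1)) in * by (field; lra). lra.
Qed.

(** With [harm_minus_ln_decr] this encloses Euler's constant between an increasing and a decreasing
    sequence, giving both the limit and an explicit error of order [1/n]. *)
Lemma harm_minus_ln_succ_incr (n : nat) :
  harm n - ln (INR (S n)) <= harm (S n) - ln (INR (S (S n))).
Proof.
  unfold harm. rewrite sum1_S, (S_INR (S n)). assert (0 < INR (S n)) by (apply INR_gt0; lia).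
  pose proof (ln_diff_bounds (INR (S n)) 1 ltac:(lra) ltac:(lra)).
  replace (1 / INR (S n)) with (/ INR (S n)) in * by (field; lra). lra.
Qed.

Lemma harm_ge_ln (n : nat) : 0 <= harm n - ln (INR (S n)).
Proof.
  induction n as [|n IH]; [unfold harm; simpl; rewrite ln_1; lra|].
  pose proof (harm_minus_ln_succ_incr n). lra.
Qed.

Lemma euler_gamma_lim : is_lim_seq (fun n => harm n - ln (INR n)) euler_gamma.
Proof.
  apply is_lim_seq_real, ex_finite_lim_seq_shift. apply ex_finite_lim_seq_decr with 0.
  - intros n. apply harm_minus_ln_decr. lia.
  - intros n. pose proof (harm_ge_ln (S n)).
    assert (ln (INR (S n)) <= ln (INR (S (S n)))); [|lra].
    apply ln_le; [apply INR_gt0; lia|apply le_INR; lia].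
Qed.

Lemma is_lim_seq_inv_shift (x : R) : is_lim_seq (fun n => / (x + INR n)) 0.
Proof.
  apply (is_lim_seq_inv _ p_infty); [|discriminate].
  apply (is_lim_seq_plus _ _ x p_infty); [apply is_lim_seq_const|apply is_lim_seq_INR|reflexivity].
Qed.

Lemma digN_gK (n : nat) (x : R) :
  digN n x = gK n x - (harm n - ln (INR n)) - / x.
Proof.
  unfold digN, psum, gK. rewrite sum1_minus. fold (harm n).
  rewrite (sum1_ext (fun k => / (x + INR k)) (fun k => / (INR k + x))); [ring|].
  intros k _. rewrite Rplus_comm. reflexivity.
Qed.

Lemma digN_lim (x : R) : 0 < x -> is_lim_seq (fun n => digN n x) (digamma x).
Proof.
  intros Hx. apply is_lim_seq_real.
  assert (ex_finite_lim_seq (fun n => gK n x)) as [l Hl].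
  { assert (T : forall k, (1 <= k)%nat -> 0 <= / INR k - / (INR k + x) <= x * / INR k ^ 2).
    { intros k Hk. pose proof (INR_gt0 k Hk).
      replace (/ INR k - / (INR k + x)) with (x * / (INR k * (INR k + x))) by (field; lra).
      split.
      - apply Rmult_le_pos; [lra|]. apply Rlt_le, Rinv_0_lt_compat. nra.
      - apply Rmult_le_compat_l; [lra|]. apply Rinv_le_contravar; nra. }
    apply ex_finite_lim_seq_incr with (x * 2).
    - intros n. apply sum1_incr. intros k. apply T. lia.
    - intros n. apply Rle_trans with (x * zetaK 2 n).
      + unfold zetaK. rewrite <- sum1_scal. apply sum1_le. intros k Hk. apply T. lia.
      + apply Rmult_le_compat_l; [lra|]. apply zetaK_le2. lia. }
  exists (l - euler_gamma - / x).
  apply is_lim_seq_ext with (fun n => gK n x - (harm n - ln (INR n)) - / x).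
  - intros n. symmetry. apply digN_gK.
  - apply is_lim_seq_minus'; [apply is_lim_seq_minus'; [exact Hl|apply euler_gamma_lim]|apply is_lim_seq_const].
Qed.

Lemma trigN_le (n : nat) (x : R) : 0 < x -> trigN n x <= / x ^ 2 + / x.
Proof.
  intros Hx. unfold trigN, psum. apply Rplus_le_compat_l.
  pose proof (inv_sqr_tail x n Hx). pose proof (pos_INR n).
  assert (0 < / (x + INR n)) by (apply Rinv_0_lt_compat; lra). lra.
Qed.

Lemma trigN_lim (x : R) : 0 < x -> is_lim_seq (fun n => trigN n x) (trigamma x).
Proof.
  intros Hx. apply is_lim_seq_real. apply ex_finite_lim_seq_incr with (/ x ^ 2 + / x).
  - intros n. unfold trigN, psum. apply Rplus_le_compat_l, sum1_incr. intros k.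
    apply Rlt_le, Rinv_0_lt_compat, pow_lt. pose proof (pos_INR (S k)). lra.
  - intros n. apply trigN_le, Hx.
Qed.

Lemma is_derive_lgamma (x : R) : 0 < x -> is_derive lgamma x (digamma x).
Proof.
  intros Hx. apply is_derive_of_limits with (f := lgN) (d := digN) (M := 2 * (/ x ^ 2 + / x)) (r := x / 2).
  - lra.
  - intros y Hy. apply lgN_lim. apply Rabs_def2 in Hy. lra.
  - apply digN_lim, Hx.
  - intros n y Hy. apply Rabs_def2 in Hy. set (h := y - x) in *.
    assert (Ey : y = x + h) by (unfold h; ring). rewrite Ey.
    unfold lgN, digN.
    replace (ln (INR (fact n)) + (x + h) * ln (INR n) - psum ln n (x + h)
       - (ln (INR (fact n)) + x * ln (INR n) - psum ln n x) - h * (ln (INR n) - psum Rinv n x))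
      with (- (psum ln n (x + h) - psum ln n x - h * psum Rinv n x)) by ring.
    rewrite Rabs_Ropp.
    apply Rle_trans with (2 * h ^ 2 * trigN n x).
    + apply psum_taylor; [exact Hx|]. intros t Ht.
      pose proof (ln_diff_bounds t h ltac:(lra) ltac:(lra)) as [A B].
      assert (C : h / t - h / (t + h) <= 2 * h ^ 2 * / t ^ 2).
      { replace (h / t - h / (t + h)) with (h ^ 2 * / (t * (t + h))) by (field; lra).
        replace (2 * h ^ 2 * / t ^ 2) with (h ^ 2 * / (t * (t / 2))) by (field; lra).
        apply Rmult_le_compat_l; [apply pow2_ge_0|]. apply Rinv_le_contravar; nra. }
      fold (h / t). apply Rabs_le.
      assert (0 <= 2 * h ^ 2 * / t ^ 2).
      { apply Rmult_le_pos; [pose proof (pow2_ge_0 h); lra|]. apply Rlt_le, Rinv_0_lt_compat, pow_lt. lra. }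
      lra.
    + rewrite (Rmult_comm 2), Rmult_assoc, (Rmult_comm _ (h ^ 2)).
      apply Rmult_le_compat_l; [apply pow2_ge_0|]. pose proof (trigN_le n x Hx). lra.
Qed.

Lemma is_derive_digamma (x : R) : 0 < x -> is_derive digamma x (trigamma x).
Proof.
  intros Hx. apply is_derive_of_limits with (f := digN) (d := trigN) (M := 2 / x * (/ x ^ 2 + / x)) (r := x / 2).
  - lra.
  - intros y Hy. apply digN_lim. apply Rabs_def2 in Hy. lra.
  - apply trigN_lim, Hx.
  - intros n y Hy. apply Rabs_def2 in Hy. set (h := y - x) in *.
    assert (Ey : y = x + h) by (unfold h; ring). rewrite Ey.
    assert (E : psum (fun t => - / t ^ 2) n x = - trigN n x).
    { unfold trigN, psum. rewrite (sum1_ext _ (fun k => -1 * / (x + INR k) ^ 2)) by (intros; ring).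
      rewrite sum1_scal. ring. }
    unfold digN.
    replace (ln (INR n) - psum Rinv n (x + h) - (ln (INR n) - psum Rinv n x) - h * trigN n x)
      with (- (psum Rinv n (x + h) - psum Rinv n x - h * psum (fun t => - / t ^ 2) n x)) by (rewrite E; ring).
    rewrite Rabs_Ropp.
    apply Rle_trans with (2 / x * h ^ 2 * trigN n x).
    + apply psum_taylor; [exact Hx|]. intros t Ht.
      replace (/ (t + h) - / t - h * - / t ^ 2) with (h ^ 2 * / (t + h) * / t ^ 2) by (field; lra).
      assert (0 < / t ^ 2) by (apply Rinv_0_lt_compat, pow_lt; lra).
      assert (0 < / (t + h)) by (apply Rinv_0_lt_compat; lra).
      rewrite Rabs_pos_eq.
      * apply Rmult_le_compat_r; [lra|]. rewrite (Rmult_comm (2 / x)).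
        apply Rmult_le_compat_l; [apply pow2_ge_0|].
        replace (2 / x) with (/ (x / 2)) by (field; lra). apply Rinv_le_contravar; lra.
      * apply Rmult_le_pos; [|lra]. apply Rmult_le_pos; [apply pow2_ge_0|lra].
    + rewrite (Rmult_comm (2 / x)), Rmult_assoc, (Rmult_comm _ (h ^ 2)).
      apply Rmult_le_compat_l; [apply pow2_ge_0|].
      apply Rmult_le_compat_l; [apply Rlt_le, Rdiv_lt_0_compat; lra|]. apply trigN_le, Hx.
Qed.

Lemma gauss_lim_pos (x : R) : 0 < x -> is_lim_seq (fun n => gauss n x) (exp (lgamma x)).
Proof.
  intros Hx. apply is_lim_seq_ext with (fun n => exp (lgN n x)).
  - intros n. symmetry. apply gauss_exp, Hx.
  - apply (is_lim_seq_continuous exp); [|apply lgN_lim, Hx].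
    apply derivable_continuous_pt, derivable_pt_exp.
Qed.

Lemma Gamma_eq_lim (x l : R) : is_lim_seq (fun n => gauss n x) l -> Gamma x = l.
Proof.
  intros H. apply is_lim_seq_unique in H. unfold Gamma. unfold gauss in H. rewrite H. reflexivity.
Qed.

(** The invariant carried from [x + 1] to [x] when descending to the negative axis. It includes
    [Gamma x <> 0] because [psi] divides by [Gamma]. *)
Definition gamma_regular (x : R) : Prop :=
  is_lim_seq (fun n => gauss n x) (Gamma x) /\ Gamma x <> 0
  /\ is_derive Gamma x (Gamma x * digamma x)
  /\ is_lim_seq (fun n => digN n x) (digamma x)
  /\ is_derive digamma x (trigamma x)
  /\ is_lim_seq (fun n => trigN n x) (trigamma x).

Lemma gamma_regular_pos (x : R) : 0 < x -> gamma_regular x.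
Proof.
  intros Hx. assert (E : forall y, 0 < y -> Gamma y = exp (lgamma y)).
  { intros y Hy. apply Gamma_eq_lim, gauss_lim_pos, Hy. }
  split; [rewrite E by exact Hx; apply gauss_lim_pos, Hx|].
  split; [rewrite E by exact Hx; apply Rgt_not_eq, exp_pos|].
  split; [|split; [apply digN_lim, Hx|split; [apply is_derive_digamma, Hx|apply trigN_lim, Hx]]].
  apply (is_derive_ext_loc (fun y => exp (lgamma y))).
  - apply (locally_interval _ x 0 p_infty); [exact Hx|exact I|]. intros y Hy _. symmetry. apply E, Hy.
  - rewrite E by exact Hx. rewrite Rmult_comm.
    apply (is_derive_comp exp lgamma x (exp (lgamma x)) (digamma x)).
    + apply is_derive_exp.
    + apply is_derive_lgamma, Hx.
Qed.

Lemma pochn_neq0 (x : R) (n : nat) : (forall k, x + INR k <> 0) -> pochn x n <> 0.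
Proof.
  intros H. induction n as [|n IH].
  - specialize (H O). simpl in *. lra.
  - apply Rmult_integral_contrapositive_currified; [exact IH|apply H].
Qed.

Lemma gauss_shift_lim (x l : R) : (forall k, x + INR k <> 0) ->
  is_lim_seq (fun n => gauss n (x + 1)) l -> is_lim_seq (fun n => gauss n x) (l / x).
Proof.
  intros Hx Hl. pose proof (Hx O) as H0. simpl in H0. rewrite Rplus_0_r in H0.
  (* The finite form of [Gamma(x) = Gamma(x+1)/x]: the correction factor is [(n + x + 1)/n],
     meaningful for [n >= 1] and tending to 1. *)
  apply is_lim_seq_ext_loc with (fun n => gauss n (x + 1) * ((1 + (x + 1) * / (0 + INR n)) * / x)).
  - exists 1%nat. intros n Hn. pose proof (INR_gt0 n Hn). unfold gauss.
    pose proof (pochn_neq0 x n Hx). pose proof (pochn_shift x n) as E.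
    assert (Hk : x + INR n + 1 <> 0) by (rewrite Rplus_assoc, <- S_INR; apply Hx).
    assert (E' : pochn (x + 1) n = pochn x n * (x + INR n + 1) / x) by (rewrite <- E; field; exact H0).
    rewrite E', Rpower_plus, Rpower_1 by assumption. field. repeat split; try assumption; lra.
  - replace (l / x) with (l * ((1 + (x + 1) * 0) * / x)) by (field; exact H0).
    apply is_lim_seq_mult'; [exact Hl|]. apply is_lim_seq_mult'; [|apply is_lim_seq_const].
    apply is_lim_seq_plus'; [apply is_lim_seq_const|].
    apply is_lim_seq_mult'; [apply is_lim_seq_const|apply is_lim_seq_inv_shift].
Qed.

(** Regularity at [x + 1] alone would transfer the limits but not the derivatives: these need the
    functional equation on a neighbourhood, hence the local hypothesis. *)
Lemma gamma_regular_shift (x : R) : (forall k, x + INR k <> 0) ->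
  locally x (fun y => (forall k, y + INR k <> 0) /\ gamma_regular (y + 1)) -> gamma_regular x.
Proof.
  intros Hx Hloc. pose proof (Hx O) as H0. simpl in H0. rewrite Rplus_0_r in H0.
  pose proof (proj2 (locally_singleton _ _ Hloc)) as Hr1.
  pose proof Hr1 as (G1 & G2 & G3 & G4 & G5 & G6).
  assert (E : forall y, (forall k, y + INR k <> 0) -> gamma_regular (y + 1) -> Gamma y = Gamma (y + 1) / y).
  { intros y Hy [L _]. apply Gamma_eq_lim, gauss_shift_lim; assumption. }
  assert (Ld : forall y, gamma_regular (y + 1) ->
    is_lim_seq (fun n => digN n y) (digamma (y + 1) - / y)).
  { intros y (_ & _ & _ & L & _).
    apply is_lim_seq_ext with (fun n => digN n (y + 1) - / y + / (y + 1 + INR n)).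
    - intros n. unfold digN. rewrite (psum_shift Rinv n y).
      replace (y + 1 + INR n) with (y + INR n + 1) by ring. ring.
    - replace (digamma (y + 1) - / y) with (digamma (y + 1) - / y + 0) by ring.
      apply is_lim_seq_plus'; [apply is_lim_seq_minus'; [exact L|apply is_lim_seq_const]|apply is_lim_seq_inv_shift]. }
  assert (Ed : forall y, gamma_regular (y + 1) -> digamma y = digamma (y + 1) - / y).
  { intros y Hy. unfold digamma at 1. rewrite (is_lim_seq_unique _ _ (Ld y Hy)). reflexivity. }
  assert (Lt : is_lim_seq (fun n => trigN n x) (trigamma (x + 1) + / x ^ 2)).
  { apply is_lim_seq_ext with (fun n => trigN n (x + 1) + / x ^ 2 - / (x + 1 + INR n) * / (x + 1 + INR n)).
    - intros n. unfold trigN. rewrite (psum_shift (fun t => / t ^ 2) n x).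
      replace (x + 1 + INR n) with (x + INR n + 1) by ring. rewrite <- Rinv_mult.
      replace ((x + INR n + 1) * (x + INR n + 1)) with ((x + INR n + 1) ^ 2) by ring. ring.
    - replace (trigamma (x + 1) + / x ^ 2) with (trigamma (x + 1) + / x ^ 2 - 0 * 0) by ring.
      apply is_lim_seq_minus'; [apply is_lim_seq_plus'; [exact G6|apply is_lim_seq_const]|].
      apply is_lim_seq_mult'; apply is_lim_seq_inv_shift. }
  assert (Et : trigamma x = trigamma (x + 1) + / x ^ 2).
  { unfold trigamma at 1. rewrite (is_lim_seq_unique _ _ Lt). reflexivity. }
  assert (Hshift : forall (F : R -> R) (l : R), is_derive F (x + 1) l -> is_derive (fun y => F (y + 1)) x l).
  { intros F l HF. replace l with (1 * l) by ring.
    apply (is_derive_comp F (fun y => y + 1) x l 1); [exact HF|]. auto_derive; [exact I|ring]. }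
  split; [rewrite E by assumption; apply gauss_shift_lim; assumption|].
  split.
  { rewrite E by assumption. unfold Rdiv. apply Rmult_integral_contrapositive_currified; [exact G2|].
    apply Rinv_neq_0_compat, H0. }
  split.
  { apply (is_derive_ext_loc (fun y => Gamma (y + 1) / y)).
    - apply filter_imp with (2 := Hloc). intros y [Hy1 Hy2]. symmetry. apply E; assumption.
    - rewrite Ed, E by assumption.
      replace (Gamma (x + 1) / x * (digamma (x + 1) - / x))
        with ((Gamma (x + 1) * digamma (x + 1) * x - Gamma (x + 1) * 1) / x ^ 2) by (field; exact H0).
      apply (is_derive_div (fun y => Gamma (y + 1)) (fun y => y) x); [apply Hshift, G3| |exact H0].
      apply (is_derive_id x). }
  split; [rewrite Ed by assumption; apply Ld; assumption|].
  split; [|rewrite Et; exact Lt].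
  apply (is_derive_ext_loc (fun y => digamma (y + 1) - / y)).
  - apply filter_imp with (2 := Hloc). intros y [_ Hy2]. symmetry. apply Ed, Hy2.
  - rewrite Et. replace (trigamma (x + 1) + / x ^ 2) with (trigamma (x + 1) - (- / x ^ 2)) by ring.
    apply (is_derive_minus (fun y => digamma (y + 1)) (fun y => / y) x); [apply Hshift, G5|].
    auto_derive; [exact H0|]. field. exact H0.
Qed.

Lemma gamma_regular_neg (m : nat) (x : R) : - INR (S m) < x < - INR m -> gamma_regular x.
Proof.
  revert x. induction m as [|m IH]; intros x Hx.
  - simpl in Hx.
    assert (NZ : forall y, -1 < y < 0 -> forall k, y + INR k <> 0).
    { intros y Hy [|k]; [simpl; lra|]. rewrite S_INR. pose proof (pos_INR k). lra. }
    apply gamma_regular_shift; [apply NZ; lra|].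
    apply (locally_interval _ x (-1) 0); simpl; try lra. intros y H1 H2. simpl in H1, H2.
    split; [apply NZ; lra|apply gamma_regular_pos; lra].
  - rewrite (S_INR (S m)), S_INR in Hx.
    assert (NZ : forall y, - INR m - 2 < y < - INR m - 1 -> forall k, y + INR k <> 0).
    { intros y Hy k. destruct (le_lt_dec k (S m)) as [L|L].
      - apply le_INR in L. rewrite S_INR in L. lra.
      - apply (le_INR (S (S m))) in L. rewrite !S_INR in L. lra. }
    apply gamma_regular_shift; [apply NZ; lra|].
    apply (locally_interval _ x (- INR m - 2) (- INR m - 1)); simpl; try lra.
    intros y H1 H2. simpl in H1, H2.
    split; [apply NZ; lra|]. apply IH. rewrite S_INR. lra.
Qed.

Lemma psi_digamma (x : R) : gamma_regular x -> psi x = digamma x.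
Proof.
  intros (_ & H0 & HD & _). unfold psi. rewrite (is_derive_unique _ _ _ HD). field. exact H0.
Qed.

Lemma psi1_trigamma (x : R) : locally x gamma_regular -> psi1 x = trigamma x.
Proof.
  intros H. destruct (locally_singleton _ _ H) as (_ & _ & _ & _ & HD & _).
  unfold psi1. rewrite (Derive_ext_loc psi digamma).
  - apply is_derive_unique, HD.
  - apply filter_imp with (2 := H). apply psi_digamma.
Qed.

Lemma psi1_pos (x : R) : 0 < x -> psi1 x = trigamma x.
Proof.
  intros Hx. apply psi1_trigamma.
  apply (locally_interval _ x 0 p_infty); [exact Hx|exact I|]. intros y Hy _. apply gamma_regular_pos, Hy.
Qed.

Lemma psi1_neg (m : nat) (x : R) : - INR (S m) < x < - INR m -> psi1 x = trigamma x.
Proof.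
  intros Hx. apply psi1_trigamma.
  apply (locally_interval _ x (- INR (S m)) (- INR m)); [apply Hx|apply Hx|].
  intros y H1 H2. apply gamma_regular_neg with m. split; assumption.
Qed.

Lemma Gamma_succ (x : R) : 0 < x -> Gamma (x + 1) = x * Gamma x.
Proof.
  intros Hx. rewrite (Gamma_eq_lim x (Gamma (x + 1) / x)); [field; lra|].
  apply gauss_shift_lim.
  - intros k. pose proof (pos_INR k). lra.
  - apply gamma_regular_pos. lra.
Qed.

Lemma Gamma_gt0 (x : R) : 0 < x -> 0 < Gamma x.
Proof. intros Hx. rewrite (Gamma_eq_lim x _ (gauss_lim_pos x Hx)). apply exp_pos. Qed.

Lemma Gamma_pochn (x : R) (n : nat) : 0 < x -> Gamma (INR n + 1 + x) = pochn x n * Gamma x.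
Proof.
  intros Hx. induction n as [|n IH].
  - simpl. rewrite Rplus_0_l, Rplus_comm. apply Gamma_succ, Hx.
  - replace (INR (S n) + 1 + x) with (INR n + 1 + x + 1) by (rewrite S_INR; ring).
    pose proof (pos_INR n). rewrite Gamma_succ, IH by lra.
    change (pochn x (S n)) with (pochn x n * (x + INR (S n))). rewrite S_INR. ring.
Qed.

Lemma Gamma_1 : Gamma 1 = 1.
Proof.
  apply Gamma_eq_lim. apply is_lim_seq_ext_loc with (fun n => 1 - / (1 + INR n)).
  - exists 1%nat. intros n Hn. pose proof (INR_gt0 n Hn). unfold gauss. rewrite Rpower_1 by assumption.
    assert (E : pochn 1 n = INR (fact n) * (INR n + 1)).
    { clear. induction n as [|n IH]; [simpl; ring|].
      change (pochn 1 (S n)) with (pochn 1 n * (1 + INR (S n))). rewrite IH.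
      change (fact (S n)) with (S n * fact n)%nat. rewrite mult_INR, S_INR. ring. }
    rewrite E. pose proof (INR_fact_lt_0 n). field. lra.
  - replace 1 with (1 - 0) at 1 by ring. apply is_lim_seq_minus'; [apply is_lim_seq_const|apply is_lim_seq_inv_shift].
Qed.

Lemma Gamma_fact (n : nat) : Gamma (INR n + 1) = INR (fact n).
Proof.
  induction n as [|n IH]; [simpl; rewrite Rplus_0_l; apply Gamma_1|].
  pose proof (pos_INR n). rewrite S_INR, Gamma_succ, IH by lra.
  change (fact (S n)) with (S n * fact n)%nat. rewrite mult_INR, S_INR. ring.
Qed.

(** * Passage to the limit *)

(** In the divided difference of [gK] all terms are positive and the one with [k = i] is at least 1.
    With [x] a zero of [gK K] this bounds its distance to [y] by [|gK K y|], which forces the finite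
    zeros to converge. *)
Lemma gK_gap_expansive (K i : nat) (x y : R) : (1 <= i <= K)%nat -> in_gap i x -> in_gap i y ->
  Rabs (x - y) <= Rabs (gK K x - gK K y).
Proof.
  intros Hi Hx Hy.
  rewrite gK_diff by (intros k _; eapply in_gap_neq0; eassumption).
  rewrite Rabs_mult. rewrite <- (Rmult_1_r (Rabs (x - y))) at 1.
  apply Rmult_le_compat_l; [apply Rabs_pos|].
  eapply Rle_trans; [|apply Rle_abs].
  apply Rle_trans with (/ (INR i + x) * / (INR i + y)).
  - rewrite <- Rinv_mult. pose proof (in_gap_same_sign i i x y Hx Hy). destruct Hx, Hy.
    rewrite <- Rinv_1 at 1. apply Rinv_le_contravar; nra.
  - apply (sum1_ge_term (fun k => / (INR k + x) * / (INR k + y))); [|exact Hi].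
    intros k _. rewrite <- Rinv_mult. apply Rlt_le, Rinv_0_lt_compat, (in_gap_same_sign i); assumption.
Qed.

Lemma sum1_Rabs (f : nat -> R) (n : nat) : Rabs (sum1 f n) <= sum1 (fun k => Rabs (f k)) n.
Proof.
  induction n as [|n IH]; [simpl; rewrite Rabs_R0; lra|]. rewrite !sum1_S.
  eapply Rle_trans; [apply Rabs_triang|]. lra.
Qed.

(** From [|2u + h| <= 3|u|] and [|u + h| >= |u|/2] the relative error is at most [12 |h|/|u|], and
    [|u| >= 2e] makes this [6 |h|/e]. *)
Lemma inv_sqr_perturb (u h e : R) : 0 < e -> 2 * e <= Rabs u -> Rabs h <= e ->
  Rabs (/ (u + h) ^ 2 - / u ^ 2) <= 6 / e * Rabs h * / u ^ 2.
Proof.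
  intros He Hu Hh.
  assert (HU : Rabs u <= 2 * Rabs (u + h)).
  { pose proof (Rabs_triang (u + h) (- h)) as T. replace (u + h + - h) with u in T by ring.
    rewrite Rabs_Ropp in T. lra. }
  assert (Hu0 : u <> 0) by (intros E; rewrite E, Rabs_R0 in Hu; lra).
  assert (Hw0 : u + h <> 0) by (intros E; rewrite E, Rabs_R0 in HU; lra).
  replace (/ (u + h) ^ 2 - / u ^ 2) with ((- h) * (2 * u + h) * (/ (u + h) ^ 2 * / u ^ 2)) by (field; tauto).
  rewrite !Rabs_mult, Rabs_Ropp, !Rabs_inv, <- !RPow_abs.
  assert (T : Rabs (2 * u + h) <= 3 * Rabs u).
  { eapply Rle_trans; [apply Rabs_triang|]. rewrite Rabs_mult, (Rabs_pos_eq 2) by lra. lra. }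
  rewrite <- (pow2_abs u). pose proof (Rabs_pos h). set (U := Rabs u) in *. set (W := Rabs (u + h)) in *.
  set (H' := Rabs h) in *. set (V := Rabs (2 * u + h)) in *.
  assert (HV : 0 <= V) by apply Rabs_pos.
  assert (HW : 0 < W) by lra.
  replace (6 / e * H' * / U ^ 2) with (H' * (6 / e) * / U ^ 2) by ring.
  rewrite <- Rmult_assoc.
  assert (0 < / U ^ 2) by (apply Rinv_0_lt_compat, pow_lt; lra).
  apply Rmult_le_compat_r; [lra|]. rewrite Rmult_assoc. apply Rmult_le_compat_l; [assumption|].
  apply Rmult_le_reg_r with (e * W ^ 2); [apply Rmult_lt_0_compat; [lra|apply pow_lt, HW]|].
  replace (V * / W ^ 2 * (e * W ^ 2)) with (V * e) by (field; lra).
  replace (6 / e * (e * W ^ 2)) with (6 * W ^ 2) by (field; lra). nra.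
Qed.

(** With [e] half the distance from [x] to the nearer end of the gap, each term changes by a small
    relative amount, so the estimate sums with a constant independent of [K]. It is needed because
    [dgK] is evaluated at zeros that move with [K]. *)
Lemma dgK_perturb (i : nat) (x : R) : in_gap i x ->
  exists e, 0 < e /\ forall K y, Rabs (y - x) <= e ->
    Rabs (dgK K y - dgK K x) <= 6 / e * Rabs (y - x) * dgK K x.
Proof.
  intros Hx. exists (Rmin (- INR i - x) (x + INR i + 1) / 2).
  set (e := Rmin (- INR i - x) (x + INR i + 1) / 2).
  assert (He : 0 < e).
  { unfold e, Rdiv. apply Rmult_lt_0_compat; [|lra]. destruct Hx. apply Rmin_pos; lra. }
  split; [exact He|]. intros K y Hy.
  unfold dgK. rewrite <- sum1_minus, <- sum1_scal.
  eapply Rle_trans; [apply sum1_Rabs|]. apply sum1_le. intros k Hk.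
  replace (INR k + y) with (INR k + x + (y - x)) by ring.
  apply inv_sqr_perturb; [exact He| |exact Hy].
  pose proof (Rmin_l (- INR i - x) (x + INR i + 1)). pose proof (Rmin_r (- INR i - x) (x + INR i + 1)).
  destruct Hx. destruct (le_lt_dec k i) as [L|L].
  - apply le_INR in L. rewrite Rabs_left1 by lra. unfold e. lra.
  - apply (le_INR (S i)) in L. rewrite S_INR in L. rewrite Rabs_pos_eq by lra. unfold e. lra.
Qed.

Lemma is_lim_seq_sum1 (f : nat -> nat -> R) (g : nat -> R) (n : nat) :
  (forall i, (1 <= i <= n)%nat -> is_lim_seq (fun m => f m i) (g i)) ->
  is_lim_seq (fun m => sum1 (f m) n) (sum1 g n).
Proof.
  induction n as [|n IH]; intros H; [apply is_lim_seq_const|]. simpl.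
  apply is_lim_seq_plus'; [apply IH; intros|]; apply H; lia.
Qed.

(** Replacing [j] by [j + 1] telescopes: [gK] gains [1/(j+1) - 1/(j+1+K)]. *)
Lemma gK_nat_lim (j : nat) : is_lim_seq (fun K => gK K (INR j)) (harm j).
Proof.
  induction j as [|j IH].
  - apply is_lim_seq_ext with (fun _ => 0); [|apply is_lim_seq_const].
    intros n. symmetry. apply gK_0.
  - apply is_lim_seq_ext with (fun K => gK K (INR j) + (/ INR (S j) - / (INR (S j) + INR K))).
    + intros K. induction K as [|K IHK]; [unfold gK; simpl sum1; simpl (INR 0); rewrite Rplus_0_r; ring|].
      unfold gK in *. rewrite !sum1_S, <- IHK.
      replace (INR (S j) + INR (S K)) with (INR (S K) + INR (S j)) by ring.
      replace (INR (S j) + INR K) with (INR (S K) + INR j) by (rewrite !S_INR; ring). ring.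
    + change (harm (S j)) with (harm j + / INR (S j)).
      replace (harm j + / INR (S j)) with (harm j + (/ INR (S j) - 0)) by ring.
      apply is_lim_seq_plus'; [exact IH|].
      apply is_lim_seq_minus'; [apply is_lim_seq_const|apply is_lim_seq_inv_shift].
Qed.

Lemma altsum_gK_lim (N : nat) :
  is_lim_seq (fun m => altsum N (fun j => / (INR j * gK (S m) (INR j))))
    (altsum N (fun j => / (INR j * harm j))).
Proof.
  unfold altsum. apply is_lim_seq_sum1. intros j Hj.
  apply (is_lim_seq_scal_l _ _ (/ (INR j * harm j))).
  pose proof (INR_gt0 j ltac:(lia)). pose proof (harm_gt0 j ltac:(lia)).
  apply (is_lim_seq_inv _ (INR j * harm j)); [|intros E; injection E; nra].
  apply (is_lim_seq_scal_l _ _ (harm j)).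
  apply (is_lim_seq_incr_1 (fun K => gK K (INR j))), gK_nat_lim.
Qed.

Lemma beta_int_lim (N : nat) (u : nat -> R) (a : R) : 0 < a ->
  is_lim_seq u a -> is_lim_seq (fun m => beta_int N (u m)) (beta_int N a).
Proof.
  intros Ha Hu. unfold beta_int, Rdiv.
  apply is_lim_seq_mult'; [apply is_lim_seq_const|].
  pose proof (pochn_gt0 a N Ha).
  apply (is_lim_seq_inv _ (pochn a N)); [|intros E; injection E; lra]. clear H.
  induction N as [|N IH]; [exact Hu|].
  change (is_lim_seq (fun m => pochn (u m) N * (u m + INR (S N))) (pochn a N * (a + INR (S N)))).
  apply is_lim_seq_mult'; [exact IH|]. apply is_lim_seq_plus'; [exact Hu|apply is_lim_seq_const].
Qed.

Lemma beta_int_gt0 (N : nat) (a : R) : 0 < a -> 0 < beta_int N a.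
Proof. intros Ha. apply Rdiv_lt_0_compat; [apply INR_fact_lt_0|apply pochn_gt0, Ha]. Qed.

(** All quotients [(a+k)/(b+k)] are at most 1, and the one with [k = 0] is kept. This extra [a/b],
    together with the [1/b] of the residue, makes the tail summable. *)
Lemma beta_int_decr (N : nat) (a b : R) : 0 < a <= b -> beta_int N b <= a / b * beta_int N a.
Proof.
  intros [Ha Hab].
  assert (H : b * pochn a N <= a * pochn b N).
  { induction N as [|N IH]; [simpl; lra|].
    change (b * (pochn a N * (a + INR (S N))) <= a * (pochn b N * (b + INR (S N)))).
    pose proof (pochn_gt0 a N Ha). pose proof (pochn_gt0 b N ltac:(lra)). pose proof (pos_INR (S N)).
    rewrite <- !Rmult_assoc. apply Rmult_le_compat; nra. }
  unfold beta_int. pose proof (pochn_gt0 a N Ha). pose proof (pochn_gt0 b N ltac:(lra)).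
  pose proof (INR_fact_lt_0 N).
  apply Rmult_le_reg_r with (pochn b N * (b * pochn a N)); [apply Rmult_lt_0_compat; nra|].
  replace (INR (fact N) / pochn b N * (pochn b N * (b * pochn a N)))
    with (INR (fact N) * (b * pochn a N)) by (field; lra).
  replace (a / b * (INR (fact N) / pochn a N) * (pochn b N * (b * pochn a N)))
    with (INR (fact N) * (a * pochn b N)) by (field; lra).
  apply Rmult_le_compat_l; lra.
Qed.

Lemma beta_int_bound (a : R) : 0 < a -> exists C M, 0 <= C /\
  forall n, (M <= n)%nat -> beta_int (n - 1) a <= C * Rpower (INR n) (- a).
Proof.
  intros Ha. pose proof (gauss_lim_pos a Ha) as L.
  set (G := exp (lgamma a)) in *. assert (HG : 0 < G) by apply exp_pos.
  apply is_lim_seq_spec in L. destruct (L (mkposreal 1 Rlt_0_1)) as [M HM]. simpl in HM.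
  (* Gauss's product is eventually below its limit plus 1, and [(a + n)/n <= a + 1] accounts for
     passing from [n - 1] to [n] in the Beta integral. *)
  exists ((G + 1) * (a + 1)), (S M). split; [nra|].
  intros [|n] Hn; [lia|]. replace (S n - 1)%nat with n by lia.
  specialize (HM (S n) ltac:(lia)). apply Rabs_def2 in HM.
  assert (HN : 1 <= INR (S n)) by (rewrite S_INR; pose proof (pos_INR n); lra).
  assert (E : beta_int n a = gauss (S n) a * ((a + INR (S n)) / INR (S n)) * Rpower (INR (S n)) (- a)).
  { unfold beta_int, gauss. rewrite Rpower_Ropp. change (pochn a (S n)) with (pochn a n * (a + INR (S n))).
    change (fact (S n)) with (S n * fact n)%nat. rewrite mult_INR.
    pose proof (pochn_gt0 a n Ha). assert (0 < Rpower (INR (S n)) a) by apply exp_pos.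
    field. repeat split; lra. }
  rewrite E. apply Rmult_le_compat_r; [apply Rlt_le, exp_pos|].
  apply Rmult_le_compat.
  - rewrite gauss_exp by exact Ha. apply Rlt_le, exp_pos.
  - apply Rlt_le, Rdiv_lt_0_compat; lra.
  - lra.
  - apply Rmult_le_reg_r with (INR (S n)); [lra|].
    replace ((a + INR (S n)) / INR (S n) * INR (S n)) with (a + INR (S n)) by (field; lra). nra.
Qed.

(** A simple pole [z = -a] contributes [1/a] minus a Beta integral. The parts [1/a] do not depend on
    [N], and [partial_fractions_at0] collects them into the constant. *)
Lemma altsum_partial_fractions (m N : nat) (z : nat -> R) :
  (forall i, (1 <= i <= m)%nat -> in_gap i (z i)) ->
  (forall i, (1 <= i <= m)%nat -> gK (S m) (z i) = 0) ->
  altsum N (fun j => / (INR j * gK (S m) (INR j)))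
  = (harm N ^ 2 + zetaK 2 N) / 2 / zetaK 2 (S m)
    + zetaK 3 (S m) / zetaK 2 (S m) ^ 2 * harm N
    - (zetaK 4 (S m) / zetaK 2 (S m) ^ 2 - zetaK 3 (S m) ^ 2 / zetaK 2 (S m) ^ 3)
    + sum1 (fun i => / (dgK (S m) (z i) * - z i) * beta_int N (- z i)) m.
Proof.
  intros Hgap Hroot. pose proof (zetaK_gt0 2 (S m) ltac:(lia)) as HA.
  rewrite (altsum_ext _ _ (fun j => / zetaK 2 (S m) * / INR j ^ 2
     + (zetaK 3 (S m) / zetaK 2 (S m) ^ 2 * / INR j
     + sum1 (fun i => / (dgK (S m) (z i) * z i) * / (INR j + - z i)) m))).
  2:{ intros j Hj. pose proof (INR_gt0 j Hj). rewrite (partial_fractions m z Hgap Hroot) by assumption.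
      rewrite <- Rplus_assoc. f_equal. field. lra. }
  rewrite altsum_plus, altsum_plus, !altsum_scal, altsum_inv2, altsum_inv, altsum_sum1.
  fold (zetaK 2 N).
  rewrite <- (partial_fractions_at0 m z Hgap Hroot).
  rewrite (sum1_ext _ (fun i => / (dgK (S m) (z i) * - z i) * beta_int N (- z i)
     - / (dgK (S m) (z i) * z i) * / z i)).
  - rewrite sum1_minus. unfold Rdiv. ring.
  - intros i Hi. pose proof (Hgap i Hi) as Hz. destruct (Hgap i Hi). pose proof (INR_gt0 i ltac:(lia)).
    pose proof (dgK_ge1 (S m) i (z i) ltac:(lia) Hz).
    rewrite altsum_scal, altsum_shifted by lra. field. lra.
Qed.

(** Here [N'] residues are kept and [N] is [n - 1]. Every later term is positive and at most
    [al B/a^2], where [B] is the first omitted Beta integral, and [a >= k] for the [k]-th of them;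
    the sum of [1/k^2] is at most 2, whatever [m] is. *)
Lemma residue_tail (m N N' : nat) (z : nat -> R) : (N' < m)%nat ->
  (forall i, (1 <= i <= m)%nat -> in_gap i (z i)) ->
  let f i := / (dgK (S m) (z i) * - z i) * beta_int N (- z i) in
  Rabs (sum1 f m - sum1 f N') <= 2 * (- z (S N') * beta_int N (- z (S N'))).
Proof.
  intros HN' Hgap f. set (al := - z (S N')). set (B := beta_int N al).
  assert (Hal : 0 < al).
  { destruct (Hgap (S N') ltac:(lia)). pose proof (pos_INR (S N')). unfold al. lra. }
  assert (HB : 0 < B) by apply beta_int_gt0, Hal.
  replace m with (N' + (m - N'))%nat at 1 by lia. rewrite sum1_app.
  replace (sum1 f N' + sum1 (fun k => f (N' + k)%nat) (m - N') - sum1 f N')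
    with (sum1 (fun k => f (N' + k)%nat) (m - N')) by ring.
  assert (T : forall k, (1 <= k <= m - N')%nat -> 0 <= f (N' + k)%nat <= al * B * / INR k ^ 2).
  { intros k Hk. pose proof (Hgap (N' + k)%nat ltac:(lia)) as Hz.
    pose proof (dgK_ge1 (S m) (N' + k) _ ltac:(lia) Hz) as Hd.
    unfold f. set (a := - z (N' + k)%nat). set (d := dgK (S m) (z (N' + k)%nat)) in *.
    assert (Hk0 : 0 < INR k) by (apply INR_gt0; lia).
    assert (Hak : INR k <= a).
    { destruct Hz. rewrite plus_INR in *. pose proof (pos_INR N'). unfold a. lra. }
    assert (Hala : al <= a).
    { destruct (Nat.eq_dec k 1) as [->|Hne].
      - unfold al, a. replace (N' + 1)%nat with (S N') by lia. lra.
      - destruct Hz. destruct (Hgap (S N') ltac:(lia)).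
        assert (L : INR (S (S N')) <= INR (N' + k)) by (apply le_INR; lia).
        rewrite (S_INR (S N')) in L. unfold al, a. lra. }
    pose proof (beta_int_gt0 N a ltac:(lra)). pose proof (beta_int_decr N al a (conj Hal Hala)) as Hd2.
    fold B in Hd2. split.
    - apply Rmult_le_pos; [|lra]. apply Rlt_le, Rinv_0_lt_compat. nra.
    - apply Rle_trans with (/ a * (al / a * B)).
      + apply Rmult_le_compat; [apply Rlt_le, Rinv_0_lt_compat; nra|lra| |exact Hd2].
        apply Rinv_le_contravar; nra.
      + replace (/ a * (al / a * B)) with (al * B * / a ^ 2) by (field; lra).
        apply Rmult_le_compat_l; [nra|]. apply Rinv_le_contravar; [apply pow_lt; lra|apply pow_incr; lra]. }
  rewrite Rabs_pos_eq by (apply sum1_ge0; intros; apply T; assumption).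
  apply Rle_trans with (al * B * zetaK 2 (m - N')).
  - unfold zetaK. rewrite <- sum1_scal. apply sum1_le. intros; apply T; assumption.
  - pose proof (zetaK_le2 2 (m - N') ltac:(lia)). assert (0 < al * B) by nra. nra.
Qed.

Lemma gK_roots : exists zK : nat -> nat -> R, forall K i, (1 <= i < K)%nat ->
  in_gap i (zK K i) /\ gK K (zK K i) = 0.
Proof.
  exists (fun K i => match le_lt_dec 1 i, le_lt_dec K i with
    | left H1, right H2 => proj1_sig (gK_root K i (conj H1 H2))
    | _, _ => 0 end).
  intros K i [H1 H2]. destruct (le_lt_dec 1 i) as [H1'|]; [|lia].
  destruct (le_lt_dec K i) as [|H2']; [lia|].
  exact (proj2_sig (gK_root K i (conj H1' H2'))).
Qed.

(** The finite form of [g(x-1) = psi(x) - psi(1)]; the poles [0, ..., -n] of [digN n] correspond to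
    the [n + 1] poles of [gK (S n)]. *)
Lemma gK_digN (n : nat) (x : R) : gK (S n) (x - 1) = digN n x - digN n 1.
Proof.
  unfold gK, digN, psum. rewrite sum1_minus, !sum1_first.
  rewrite (sum1_ext (fun k => / INR (S k)) (fun k => / (1 + INR k))).
  2:{ intros k _. rewrite S_INR, Rplus_comm. reflexivity. }
  rewrite (sum1_ext (fun k => / (INR (S k) + (x - 1))) (fun k => / (x + INR k))).
  2:{ intros k _. rewrite S_INR. f_equal. ring. }
  simpl (INR 1). replace (1 + (x - 1)) with x by ring. ring.
Qed.

Lemma dgK_trigN (n : nat) (x : R) : dgK (S n) (x - 1) = trigN n x.
Proof.
  unfold dgK, trigN, psum. rewrite sum1_first.
  rewrite (sum1_ext (fun k => / (INR (S k) + (x - 1)) ^ 2) (fun k => / (x + INR k) ^ 2)).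
  2:{ intros k _. rewrite S_INR. do 2 f_equal. ring. }
  simpl (INR 1). replace (1 + (x - 1)) with x by ring. ring.
Qed.

(** This converts the power sum left by the double pole into the [psi'(n)] term, with
    [n = N + 1]. *)
Lemma psi1_nat (N : nat) : psi1 (INR (S N)) = zeta 2 - zetaK 2 N.
Proof.
  assert (H0 : 0 < INR (S N)) by (apply INR_gt0; lia).
  rewrite psi1_pos by exact H0.
  assert (L : is_lim_seq (fun n => trigN n (INR (S N))) (zeta 2 - zetaK 2 N)).
  { apply is_lim_seq_ext with (fun n => zetaK 2 (n + S N) - zetaK 2 N).
    - intros n. unfold zetaK. replace (n + S N)%nat with (N + S n)%nat by lia.
      rewrite sum1_app, sum1_first. unfold trigN, psum.
      rewrite (sum1_ext (fun k => / INR (N + S k) ^ 2) (fun k => / (INR (S N) + INR k) ^ 2)).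
      + replace (N + 1)%nat with (S N) by lia. ring.
      + intros k _. rewrite <- plus_INR. do 3 f_equal. lia.
    - apply is_lim_seq_minus'; [|apply is_lim_seq_const].
      apply (is_lim_seq_incr_n (zetaK 2) (S N)), zetaK_lim. lia. }
  unfold trigamma. rewrite (is_lim_seq_unique _ _ L). reflexivity.
Qed.

(** * Convergence of the finite zeros to the roots of [psi(s) = psi(1)] *)

Section Roots.

Variable s : nat -> R.
Hypothesis s_int : forall i : nat, (1 <= i)%nat -> - INR i < s i < - INR (i - 1).
Hypothesis s_root : forall i : nat, (1 <= i)%nat -> psi (s i) = psi 1.

Let s_Rabs (i : nat) : (1 <= i)%nat -> Rabs (s i) + 1 = - (s i - 1).
Proof.
  intros Hi. destruct (s_int i Hi). pose proof (pos_INR (i - 1)). rewrite Rabs_left1 by lra. ring.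
Qed.

Let s_gap (i : nat) : (1 <= i)%nat -> in_gap i (s i - 1).
Proof.
  intros Hi. destruct (s_int i Hi) as [H1 H2]. rewrite minus_INR in H2 by exact Hi. simpl (INR 1) in H2.
  unfold in_gap. lra.
Qed.

Let s_regular (i : nat) : (1 <= i)%nat -> gamma_regular (s i).
Proof.
  intros Hi. apply gamma_regular_neg with (i - 1)%nat.
  replace (S (i - 1)) with i by lia. apply s_int, Hi.
Qed.

Let gK_s_lim (i : nat) : (1 <= i)%nat -> is_lim_seq (fun n => gK (S n) (s i - 1)) 0.
Proof.
  intros Hi. apply is_lim_seq_ext with (fun n => digN n (s i) - digN n 1).
  - intros n. symmetry. apply gK_digN.
  - assert (H1 : gamma_regular 1) by (apply gamma_regular_pos; lra).
    assert (L1 : is_lim_seq (fun n => digN n 1) (digamma 1)) by apply H1.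
    assert (Ls : is_lim_seq (fun n => digN n (s i)) (digamma (s i))) by apply s_regular, Hi.
    replace 0 with (digamma (s i) - digamma 1).
    + apply is_lim_seq_minus'; [exact Ls|exact L1].
    + rewrite <- !psi_digamma, s_root by auto. ring.
Qed.

Let dgK_s_lim (i : nat) : (1 <= i)%nat -> is_lim_seq (fun n => dgK (S n) (s i - 1)) (psi1 (s i)).
Proof.
  intros Hi. rewrite (psi1_neg (i - 1) (s i)).
  - apply is_lim_seq_ext with (fun n => trigN n (s i)); [intros; symmetry; apply dgK_trigN|].
    apply s_regular, Hi.
  - replace (S (i - 1)) with i by lia. apply s_int, Hi.
Qed.

Variable zK : nat -> nat -> R.
Hypothesis zK_root : forall K i, (1 <= i < K)%nat -> in_gap i (zK K i) /\ gK K (zK K i) = 0.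

Let zK_lim (i : nat) : (1 <= i)%nat -> is_lim_seq (fun m => zK (S m) i) (s i - 1).
Proof.
  intros Hi.
  assert (L : is_lim_seq (fun m => zK (S m) i - (s i - 1)) 0).
  { apply is_lim_seq_abs_0.
    apply is_lim_seq_le_le_loc with (u := fun _ => 0) (w := fun m => Rabs (gK (S m) (s i - 1))).
    - exists i. intros m Hm. split; [apply Rabs_pos|].
      destruct (zK_root (S m) i ltac:(lia)) as [G R0].
      eapply Rle_trans; [apply (gK_gap_expansive (S m) i); [lia|exact G|apply s_gap, Hi]|].
      rewrite R0, Rminus_0_l, Rabs_Ropp. lra.
    - apply is_lim_seq_const.
    - replace 0 with (Rabs 0) by apply Rabs_R0. apply (is_lim_seq_abs _ 0). apply gK_s_lim, Hi. }
  apply is_lim_seq_ext with (fun m => zK (S m) i - (s i - 1) + (s i - 1)); [intros; ring|].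
  replace (Finite (s i - 1)) with (Finite (0 + (s i - 1))) by (f_equal; ring).
  apply is_lim_seq_plus'; [exact L|apply is_lim_seq_const].
Qed.

Let dgK_zK_lim (i : nat) : (1 <= i)%nat -> is_lim_seq (fun m => dgK (S m) (zK (S m) i)) (psi1 (s i)).
Proof.
  intros Hi. destruct (dgK_perturb i (s i - 1) (s_gap i Hi)) as [e [He HP]].
  assert (L0 : is_lim_seq (fun m => Rabs (zK (S m) i - (s i - 1))) 0).
  { replace 0 with (Rabs (s i - 1 - (s i - 1))) by (rewrite Rminus_diag; apply Rabs_R0).
    apply (is_lim_seq_abs _ (s i - 1 - (s i - 1))).
    apply is_lim_seq_minus'; [apply zK_lim, Hi|apply is_lim_seq_const]. }
  assert (L : is_lim_seq (fun m => dgK (S m) (zK (S m) i) - dgK (S m) (s i - 1)) 0).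
  { apply is_lim_seq_abs_0.
    apply is_lim_seq_le_le_loc with (u := fun _ => 0)
      (w := fun m => 6 / e * Rabs (zK (S m) i - (s i - 1)) * dgK (S m) (s i - 1)).
    - pose proof (proj2 (is_lim_seq_spec _ _) L0 (mkposreal e He)) as [M HM].
      exists M. intros m Hm. split; [apply Rabs_pos|]. apply HP.
      specialize (HM m Hm). simpl in HM. rewrite Rminus_0_r, Rabs_Rabsolu in HM. lra.
    - apply is_lim_seq_const.
    - replace 0 with (6 / e * 0 * psi1 (s i)) by ring.
      apply is_lim_seq_mult'; [|apply dgK_s_lim, Hi].
      apply is_lim_seq_mult'; [apply is_lim_seq_const|exact L0]. }
  apply is_lim_seq_ext with
    (fun m => dgK (S m) (zK (S m) i) - dgK (S m) (s i - 1) + dgK (S m) (s i - 1)); [intros; ring|].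
  replace (Finite (psi1 (s i))) with (Finite (0 + psi1 (s i))) by (f_equal; ring).
  apply is_lim_seq_plus'; [exact L|apply dgK_s_lim, Hi].
Qed.

(** The constant is [1/10 = 1/2 - 2/5]: the sum [zetaK 2 N = zeta(2) - psi'(n)] over [2 zeta(2)]
    gives [1/2], and [zeta(4)/zeta(2)^2 = 2/5]. Likewise [3/PI^2 = 1/(2 zeta(2))]. *)
Let main_term_eq (N' N : nat) :
  main_term s N' (S N)
  = (harm N ^ 2 + zetaK 2 N) / 2 / zeta 2 + zeta 3 / zeta 2 ^ 2 * harm N
    - (zeta 4 / zeta 2 ^ 2 - zeta 3 ^ 2 / zeta 2 ^ 3)
    + sum1 (fun i => / (psi1 (s i) * - (s i - 1)) * beta_int N (- (s i - 1))) N'.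
Proof.
  unfold main_term. replace (S N - 1)%nat with N by lia. pose proof PI_RGT_0.
  f_equal.
  - rewrite psi1_nat, zeta4_eq, zeta2_eq. field. lra.
  - apply sum1_ext. intros i Hi. rewrite <- s_Rabs by lia.
    set (a := Rabs (s i) + 1). assert (Ha : 0 < a) by (pose proof (Rabs_pos (s i)); unfold a; lra).
    replace (INR (S N) + Rabs (s i) + 1) with (INR N + 1 + a) by (rewrite S_INR; unfold a; ring).
    rewrite Gamma_pochn, (S_INR N), Gamma_fact by exact Ha. unfold beta_int.
    pose proof (pochn_gt0 a N Ha). pose proof (Gamma_gt0 a Ha).
    (* The identity is linear in [1/psi'(s_i)]; with that inverse made opaque, [field] does not ask
       for [psi'(s_i) <> 0]. *)
    unfold Rdiv. rewrite !Rinv_mult. generalize (/ psi1 (s i)); intros q. field. lra.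
Qed.

(** An inequality for every [n = N + 1], not only asymptotically. For each finite number of poles
    the error is exactly a residue tail; with [N] and [N'] fixed, both sides of its bound are finite
    expressions whose limits are taken term by term. *)
Lemma EL_expansion (N' N : nat) :
  Rabs (EL (S N) - main_term s N' (S N))
  <= 2 * ((Rabs (s (S N')) + 1) * beta_int N (Rabs (s (S N')) + 1)).
Proof.
  assert (Hpos : forall i, (1 <= i)%nat -> 0 < - (s i - 1)).
  { intros i Hi. rewrite <- s_Rabs by exact Hi. pose proof (Rabs_pos (s i)). lra. }
  assert (Lneg : forall i, (1 <= i)%nat -> is_lim_seq (fun m => - zK (S m) i) (- (s i - 1))).
  { intros i Hi. apply (is_lim_seq_opp _ (s i - 1)), zK_lim, Hi. }
  assert (Lbeta : forall i, (1 <= i)%nat ->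
    is_lim_seq (fun m => beta_int N (- zK (S m) i)) (beta_int N (- (s i - 1)))).
  { intros i Hi. apply beta_int_lim; [apply Hpos, Hi|apply Lneg, Hi]. }
  assert (Lz : forall p, (2 <= p)%nat -> is_lim_seq (fun m => zetaK p (S m)) (zeta p)).
  { intros p Hp. apply (is_lim_seq_incr_1 (zetaK p)), zetaK_lim, Hp. }
  assert (Hz2 : 0 < zeta 2).
  { rewrite zeta2_eq. pose proof PI_RGT_0. apply Rdiv_lt_0_compat; [apply pow_lt|]; lra. }
  assert (Lpow : forall u l n, is_lim_seq u (Finite l) -> is_lim_seq (fun m => u m ^ n) (l ^ n)).
  { intros u l n Hu. induction n as [|n IH]; [apply is_lim_seq_const|]. apply is_lim_seq_mult'; assumption. }
  assert (Ldiv : forall u v (l k : R), is_lim_seq u l -> is_lim_seq v k -> k <> 0 ->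
    is_lim_seq (fun m => u m / v m) (l / k)).
  { intros u v l k Hu Hv Hk. apply is_lim_seq_div'; assumption. }
  set (f := fun m i => / (dgK (S m) (zK (S m) i) * - zK (S m) i) * beta_int N (- zK (S m) i)).
  apply (is_lim_seq_le_loc
    (fun m => Rabs (altsum N (fun j => / (INR j * gK (S m) (INR j)))
      - ((harm N ^ 2 + zetaK 2 N) / 2 / zetaK 2 (S m)
    + zetaK 3 (S m) / zetaK 2 (S m) ^ 2 * harm N
    - (zetaK 4 (S m) / zetaK 2 (S m) ^ 2 - zetaK 3 (S m) ^ 2 / zetaK 2 (S m) ^ 3)
    + sum1 (f m) N')))
    (fun m => 2 * (- zK (S m) (S N') * beta_int N (- zK (S m) (S N'))))
    (Rabs (EL (S N) - main_term s N' (S N)))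
    (2 * ((Rabs (s (S N')) + 1) * beta_int N (Rabs (s (S N')) + 1)))).
  - exists (S N'). intros m Hm.
    assert (Hg : forall i, (1 <= i <= m)%nat -> in_gap i (zK (S m) i)) by (intros i Hi; apply zK_root; lia).
    assert (Hr : forall i, (1 <= i <= m)%nat -> gK (S m) (zK (S m) i) = 0) by (intros i Hi; apply zK_root; lia).
    rewrite (altsum_partial_fractions m N (zK (S m)) Hg Hr).
    eapply Rle_trans; [|apply (residue_tail m N N' (zK (S m)) ltac:(lia) Hg)].
    apply Req_le. f_equal. unfold f. ring.
  - rewrite main_term_eq, EL_eq by lia.
    apply (is_lim_seq_abs _ (EL_closed (S N) - _)). apply is_lim_seq_minus'.
    + unfold EL_closed. replace (S N - 1)%nat with N by lia. apply altsum_gK_lim.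
    + apply is_lim_seq_plus'; [apply is_lim_seq_minus'; [apply is_lim_seq_plus'|apply is_lim_seq_minus']|].
      * apply Ldiv; [apply is_lim_seq_const|apply Lz; lia|lra].
      * apply is_lim_seq_mult'; [|apply is_lim_seq_const].
        apply Ldiv; [apply Lz; lia|apply Lpow, Lz; lia|apply pow_nonzero; lra].
      * apply Ldiv; [apply Lz; lia|apply Lpow, Lz; lia|apply pow_nonzero; lra].
      * apply Ldiv; [apply Lpow, Lz; lia|apply Lpow, Lz; lia|apply pow_nonzero; lra].
      * apply (is_lim_seq_sum1 f). intros i Hi. unfold f.
        apply is_lim_seq_mult'; [|apply Lbeta; lia].
        (* The uniform bound [dgK >= 1] survives the limit, so the denominator of the residue stays
           away from 0. *)
        assert (Hp1 : 1 <= psi1 (s i)).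
        { apply (is_lim_seq_le_loc (fun _ => 1) (fun n => dgK (S n) (s i - 1)) 1 (psi1 (s i))).
          - exists i. intros n Hn. apply dgK_ge1 with i; [lia|apply s_gap; lia].
          - apply is_lim_seq_const.
          - apply dgK_s_lim. lia. }
        pose proof (Hpos i ltac:(lia)).
        apply (is_lim_seq_inv _ (psi1 (s i) * - (s i - 1))); [|intros E; injection E; nra].
        apply is_lim_seq_mult'; [apply dgK_zK_lim; lia|apply Lneg; lia].
  - rewrite s_Rabs by lia. apply (is_lim_seq_scal_l _ 2 (- (s (S N') - 1) * beta_int N (- (s (S N') - 1)))).
    apply is_lim_seq_mult'; [apply Lneg; lia|apply Lbeta; lia].
Qed.

End Roots.

(** * The logarithmic form of the expansion *)

Lemma euler_gamma_bounds (N : nat) :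
  harm N - ln (INR (S N)) <= euler_gamma <= harm N - ln (INR (S N)) + / INR (S N).
Proof.
  assert (L : is_lim_seq (fun n => harm (S n) - ln (INR (S n))) euler_gamma)
    by apply (is_lim_seq_incr_1 (fun n => harm n - ln (INR n))), euler_gamma_lim.
  split.
  - apply (is_lim_seq_le_loc (fun _ => harm N - ln (INR (S N))) (fun n => harm (S n) - ln (INR (S n)))
      (harm N - ln (INR (S N))) euler_gamma); [|apply is_lim_seq_const|exact L].
    exists N. intros n Hn.
    apply Rle_trans with (harm n - ln (INR (S n))).
    + induction Hn as [|n Hn IH]; [lra|]. pose proof (harm_minus_ln_succ_incr n). lra.
    + unfold harm. rewrite sum1_S. assert (0 < / INR (S n)) by (apply Rinv_0_lt_compat, INR_gt0; lia). lra.
  - apply (is_lim_seq_le_loc (fun n => harm (S n) - ln (INR (S n))) (fun _ => harm N - ln (INR (S N)) + / INR (S N))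
      euler_gamma (harm N - ln (INR (S N)) + / INR (S N))); [|exact L|apply is_lim_seq_const].
    exists N. intros n Hn.
    apply Rle_trans with (harm (S N) - ln (INR (S N))).
    + induction Hn as [|n Hn IH]; [lra|]. pose proof (harm_minus_ln_decr (S n) ltac:(lia)). lra.
    + unfold harm. rewrite sum1_S. lra.
Qed.

Lemma psi1_nat_bounds (N : nat) : 0 <= psi1 (INR (S N)) <= 2 / INR (S N).
Proof.
  assert (HN : 1 <= INR (S N)) by (rewrite S_INR; pose proof (pos_INR N); lra).
  rewrite psi1_pos by lra. pose proof (trigN_lim (INR (S N)) ltac:(lra)) as L. split.
  - apply (is_lim_seq_le (fun _ => 0) (fun n => trigN n (INR (S N))) 0 (trigamma (INR (S N))));
      [|apply is_lim_seq_const|exact L].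
    intros n. unfold trigN, psum. apply Rplus_le_le_0_compat.
    + apply Rlt_le, Rinv_0_lt_compat, pow_lt. lra.
    + apply sum1_ge0. intros k _. apply Rlt_le, Rinv_0_lt_compat, pow_lt. pose proof (pos_INR k). lra.
  - apply (is_lim_seq_le (fun n => trigN n (INR (S N))) (fun _ => 2 / INR (S N))
      (trigamma (INR (S N))) (2 / INR (S N))); [|exact L|apply is_lim_seq_const].
    intros n. eapply Rle_trans; [apply trigN_le; lra|].
    assert (/ INR (S N) ^ 2 <= / INR (S N)) by (apply Rinv_le_contravar; nra). lra.
Qed.

Lemma zeta3_ge0 : 0 <= zeta 3.
Proof.
  apply (is_lim_seq_le (fun _ => 0) (zetaK 3) 0 (zeta 3)); [|apply is_lim_seq_const|apply zetaK_lim; lia].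
  intros n. apply sum1_ge0. intros k Hk. apply Rlt_le, Rinv_0_lt_compat, pow_lt, INR_gt0. lia.
Qed.

Lemma main_term_0_log (s : nat -> R) : exists C, forall n : nat, (3 <= n)%nat ->
  1 <= ln (INR n) /\
  Rabs (main_term s 0 n - (3 / PI ^ 2 * ln (INR n) ^ 2
          + (zeta 3 / zeta 2 ^ 2 + euler_gamma / zeta 2) * ln (INR n) + b0))
  <= C * (ln (INR n) / INR n).
Proof.
  pose proof PI_RGT_0 as HPI.
  assert (HP : 0 < 3 / PI ^ 2) by (apply Rdiv_lt_0_compat; [lra|apply pow_lt, HPI]).
  assert (HB : 0 <= zeta 3 / zeta 2 ^ 2).
  { apply Rmult_le_pos; [apply zeta3_ge0|]. rewrite zeta2_eq. apply Rlt_le, Rinv_0_lt_compat, pow_lt.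
    apply Rdiv_lt_0_compat; [apply pow_lt, HPI|lra]. }
  assert (HG : 0 <= euler_gamma).
  { pose proof (proj1 (euler_gamma_bounds 0)) as H. pose proof (harm_ge_ln 0). lra. }
  set (P := 3 / PI ^ 2) in *. set (B := zeta 3 / zeta 2 ^ 2) in *. set (g := euler_gamma) in *.
  (* The first two summands bound the effect of replacing [h_(n-1)] by [ln n + gamma], the last one
     that of [psi'(n) <= 2/n]. Since [ln n >= 1] for [n >= 3 >= e], every constant may be multiplied
     by [ln n]. *)
  exists (P * (2 + 2 * g) + B + 2 * P).
  intros [|N] Hn; [lia|].
  assert (HN : 3 <= INR (S N)) by (replace 3 with (INR 3) by (simpl; ring); apply le_INR, Hn).
  assert (Hl : 1 <= ln (INR (S N))).
  { rewrite <- (ln_exp 1). apply ln_le; [apply exp_pos|]. pose proof exp_le_3. lra. }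
  split; [exact Hl|].
  pose proof (euler_gamma_bounds N) as Hd. fold g in Hd.
  pose proof (psi1_nat_bounds N) as Hp. unfold main_term, b0. replace (S N - 1)%nat with N by lia.
  simpl sum1. set (l := ln (INR (S N))) in *. set (x := harm N) in *. set (n := INR (S N)) in *.
  set (p := psi1 n) in *. fold P B g.
  (* [h_(n-1) = ln n + gamma - d]. Expanding the square, the cross term [2 P gamma ln n] is the
     [gamma/zeta(2)] term, as [1/zeta(2) = 6/PI^2]. *)
  set (d := g - (x - l)). assert (Hd1 : 0 <= d <= / n) by (unfold d; lra).
  replace (P * x ^ 2 + B * x + zeta 3 ^ 2 / zeta 2 ^ 3 + 1 / 10 - P * p + 0
     - (P * l ^ 2 + (B + g / zeta 2) * l + (3 * g ^ 2 / PI ^ 2 + B * g + zeta 3 ^ 2 / zeta 2 ^ 3 + 1 / 10)))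
    with (- (d * (P * (2 * l + 2 * g - d) + B) + P * p)).
  2:{ replace (g / zeta 2) with (2 * P * g) by (rewrite zeta2_eq; unfold P; field; lra).
      replace (3 * g ^ 2 / PI ^ 2) with (P * g ^ 2) by (unfold P; field; lra).
      unfold d. ring. }
  assert (Hn1 : / n <= 1) by (rewrite <- Rinv_1; apply Rinv_le_contravar; lra).
  assert (Hn0 : 0 < / n) by (apply Rinv_0_lt_compat; lra).
  rewrite Rabs_Ropp, Rabs_pos_eq.
  - apply Rle_trans with (/ n * (P * (2 * l + 2 * g) + B) + P * (2 / n)).
    + apply Rplus_le_compat; [|apply Rmult_le_compat_l; lra].
      apply Rmult_le_compat; [lra| |lra|]; nra.
    + replace ((P * (2 + 2 * g) + B + 2 * P) * (l / n)) with
        (/ n * (P * (2 * l + 2 * (g * l)) + B * l) + P * (2 / n) * l) by (field; lra).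
      assert (g <= g * l) by nra. assert (B <= B * l) by nra.
      apply Rplus_le_compat.
      * apply Rmult_le_compat_l; [lra|]. apply Rplus_le_compat; [|assumption].
        apply Rmult_le_compat_l; lra.
      * assert (0 <= P * (2 / n)) by (apply Rmult_le_pos; [lra|]; unfold Rdiv; nra). nra.
  - apply Rplus_le_le_0_compat; [|apply Rmult_le_pos; lra].
    apply Rmult_le_pos; [lra|]. nra.
Qed.

Theorem theorem8p1 (s : nat -> R)
  (hs_int : forall i : nat, (1 <= i)%nat -> - INR i < s i < - INR (i - 1))
  (hs_root : forall i : nat, (1 <= i)%nat -> psi (s i) = psi 1) :
  (forall N : nat, exists C : R, exists M : nat, forall n : nat, (M <= n)%nat ->
      Rabs (EL n - main_term s N n) <= C * Rpower (INR n) (- 1 - Rabs (s (S N))))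
  /\
  (exists C : R, exists M : nat, forall n : nat, (M <= n)%nat ->
      Rabs (EL n - (3 / PI ^ 2 * ln (INR n) ^ 2
                    + (zeta 3 / zeta 2 ^ 2 + euler_gamma / zeta 2) * ln (INR n)
                    + b0))
      <= C * (ln (INR n) / INR n)).
Proof.
  (* The sign of [C] is recorded because the second part multiplies an inequality by it. *)
  assert (H1 : forall N : nat, exists C : R, exists M : nat, 0 <= C /\ forall n : nat, (M <= n)%nat ->
      Rabs (EL n - main_term s N n) <= C * Rpower (INR n) (- 1 - Rabs (s (S N)))).
  { intros N. destruct gK_roots as [zK HzK].
    set (a := Rabs (s (S N)) + 1).
    assert (Ha : 0 < a) by (pose proof (Rabs_pos (s (S N))); unfold a; lra).
    destruct (beta_int_bound a Ha) as [C [M [HC HM]]].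
    exists (2 * (a * C)), (S M). split; [nra|]. intros [|n] Hn; [lia|].
    eapply Rle_trans; [apply (EL_expansion s hs_int hs_root zK HzK)|]. fold a.
    replace (- 1 - Rabs (s (S N))) with (- a) by (unfold a; ring).
    specialize (HM (S n) ltac:(lia)). replace (S n - 1)%nat with n in HM by lia.
    rewrite !Rmult_assoc. apply Rmult_le_compat_l; [lra|]. apply Rmult_le_compat_l; lra. }
  split.
  - intros N. destruct (H1 N) as [C [M [_ HM]]]. exists C, M. exact HM.
  - destruct (H1 O) as [C [M [HC HM]]]. destruct (main_term_0_log s) as [C' HC'].
    exists (C + C'), (M + 3)%nat. intros n Hn.
    destruct (HC' n ltac:(lia)) as [Hl HC'n]. specialize (HM n ltac:(lia)).
    assert (Hn0 : 1 < INR n) by (apply (lt_INR 1); lia).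
    (* For [N = 0] the error exponent is at most -1, and [ln n >= 1] absorbs [1/n] into
       [ln n / n]. *)
    assert (Hp : Rpower (INR n) (- 1 - Rabs (s 1%nat)) <= ln (INR n) / INR n).
    { apply Rle_trans with (Rpower (INR n) (- 1)).
      - apply Rle_Rpower; [lra|]. pose proof (Rabs_pos (s 1%nat)). lra.
      - change (-1) with (Ropp 1). rewrite Rpower_Ropp, Rpower_1 by lra. unfold Rdiv.
        assert (0 < / INR n) by (apply Rinv_0_lt_compat; lra). nra. }
    apply Rmult_le_compat_l with (r := C) in Hp; [|exact HC].
    match goal with |- Rabs (EL n - ?t) <= _ => set (T := t) in * end.
    replace (EL n - T) with (EL n - main_term s 0 n + (main_term s 0 n - T)) by ring.
    eapply Rle_trans; [apply Rabs_triang|]. lra.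
Qed.
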